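(* Let $w\in\mathbb{C}$ with $|w|<1$, let $\phi(z)=w$ for all $z\in\mathbb{D}$, and let $\psi$ be a nonzero analytic function on $\mathbb{D}$ such that $C_{\psi,\phi}$ is a bounded operator on $\mathcal{D}$. Then: (i) If $k_w\equiv c\psi$ for some constant $c\ne0$, then $W(C_{\psi,\phi})=[0,\overline{c}\|\psi\|_{\mathcal{D}}^2]$ (the closed segment in $\mathbb{C}$ joining $0$ and $\overline{c}\|\psi\|_{\mathcal{D}}^2$). (ii) If $k_w$ and $\psi$ are orthogonal to each other in $\mathcal{D}$, then $W(C_{\psi,\phi})$ is the closed disk centered at the origin with radius $\frac12\|\psi\|_{\mathcal{D}}\|k_w\|_{\mathcal{D}}$. (iii) In all other cases, $W(C_{\psi,\phi})$ is a closed elliptical disk whose foci are $0$ and $\psi(w)$.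
   Context: $\mathbb{D}=\{z\in\mathbb{C}:|z|<1\}$. The Dirichlet space $\mathcal{D}$ is the Hilbert space of all holomorphic $f(z)=\sum_{n\ge0}\hat f_nz^n$ on $\mathbb{D}$ with $\sum_{n\ge 0}(n+1)|\hat f_n|^2<\infty$ (equivalently $\int_{\mathbb{D}}|f'|^2dA<\infty$), with inner product $\langle f,g\rangle_{\mathcal{D}}=\sum_{n\ge0}(n+1)\hat f_n\overline{\hat g_n}$ and norm $\|\cdot\|_{\mathcal{D}}$. Its reproducing kernels are $k_w(z)=\frac{1}{z\overline{w}}\log\left(\frac{1}{1-z\overline{w}}\right)$ for $w\in\mathbb{D}\setminus\{0\}$ (principal branch; value $1$ at $z=0$) and $k_0\equiv1$; thus $\langle f,k_w\rangle_{\mathcal{D}}=f(w)$ for $f\in\mathcal{D}$. The weighted composition operator is $(C_{\psi,\phi}f)(z)=\psi(z)f(\phi(z))$. The numerical range of a bounded operator $T$ on a Hilbert space $\mathcal{H}$ is $W(T)=\{\langle Tf,f\rangle:f\in\mathcal{H},\|f\|=1\}$. *)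

(* Defs.v *)
From Stdlib Require Export Reals ClassicalEpsilon.
From Coquelicot Require Export Coquelicot.

Open Scope C_scope.

Definition unit_disk (z : C) : Prop := (Cmod z < 1)%R.

Definition holomorphic_on_disk (f : C -> C) : Prop :=
  forall z : C, unit_disk z ->
    ex_derive (K := C_AbsRing) (V := C_NormedModule) f z.

(* An element of a space of functions on the disk is represented by a total
   function [C -> C]; only its values on [unit_disk] are ever used. *)
Definition eq_on_disk (f g : C -> C) : Prop :=
  forall z : C, unit_disk z -> f z = g z.

Definition expansion (f : C -> C) (a : nat -> C) : Prop :=
  forall z : C, unit_disk z ->
    is_pseries (K := C_AbsRing) (V := C_NormedModule) a z (f z).

(* The power series coefficients of [f] at 0.  They are unique when an
   expansion exists; the value is unspecified otherwise. *)
Definition coef (f : C -> C) : nat -> C :=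
  epsilon (inhabits (fun _ => RtoC 0)) (expansion f).

Definition Dirichlet (f : C -> C) : Prop :=
  holomorphic_on_disk f /\
  expansion f (coef f) /\
  ex_series (fun n => (INR (S n) * (Cmod (coef f n))^2)%R).

Definition CSeries (u : nat -> C) : C :=
  (Series (fun n => Re (u n)), Series (fun n => Im (u n))).

Definition dinner (f g : C -> C) : C :=
  CSeries (fun n => RtoC (INR (S n)) * coef f n * Cconj (coef g n)).

Definition dnorm (f : C -> C) : R := sqrt (Re (dinner f f)).

(* Argument in (-PI, PI], for z <> 0. *)
Definition Carg (z : C) : R :=
  if Rle_dec 0 (Im z) then acos (Re z / Cmod z) else (- acos (Re z / Cmod z))%R.

Definition Clog (z : C) : C := (ln (Cmod z), Carg z).

Definition kernel (w z : C) : C :=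
  if Ceq_dec w 0 then 1
  else if Ceq_dec z 0 then 1
  else / (z * Cconj w) * Clog (/ (1 - z * Cconj w)).

Definition wcomp (psi phi f : C -> C) : C -> C :=
  fun z => psi z * f (phi z).

(* The second conjunct says that [T] is well defined on functions on the
   disk. *)
Definition bounded_operator (T : (C -> C) -> (C -> C)) : Prop :=
  (forall f, Dirichlet f -> Dirichlet (T f)) /\
  (forall f g, Dirichlet f -> Dirichlet g ->
     eq_on_disk f g -> eq_on_disk (T f) (T g)) /\
  (forall (a b : C) f g, Dirichlet f -> Dirichlet g ->
     eq_on_disk (T (fun z => a * f z + b * g z))
                (fun z => a * T f z + b * T g z)) /\
  (exists M : R, forall f, Dirichlet f -> (dnorm (T f) <= M * dnorm f)%R).

Definition numerical_range (T : (C -> C) -> (C -> C)) (l : C) : Prop :=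
  exists f, Dirichlet f /\ dnorm f = 1%R /\ l = dinner (T f) f.

Definition same_set (A B : C -> Prop) : Prop := forall z : C, A z <-> B z.

Definition segment (p q : C) (z : C) : Prop :=
  exists t : R, (0 <= t <= 1)%R /\ z = RtoC (1 - t) * p + RtoC t * q.

Definition closed_disk (p : C) (r : R) (z : C) : Prop := (Cmod (z - p) <= r)%R.

(* Foci [p] and [q], major axis of length [s]; the condition on [s] makes the
   ellipse nondegenerate. *)
Definition closed_elliptical_disk (p q : C) (A : C -> Prop) : Prop :=
  exists s : R, (Cmod (p - q) < s)%R /\
    same_set A (fun z => (Cmod (z - p) + Cmod (z - q) <= s)%R).

(* Main.v *)
Require Import Defs.
From Stdlib Require Import FunctionalExtensionality Lra Lia Psatz.

(** Evaluation at [w] is the functional [f |-> <f, k_w>], and [psi] is itself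
    in the Dirichlet space because it is the image of the constant function 1.
    The operator is therefore the rank-one operator [f |-> <f, k> psi], with
    [k = k_w], and its numerical range consists of the products
    [<f, k> <psi, f>] over unit vectors [f].

    All three cases come from a single description ([numerical_range_ellipse]):
    this set is [{ l : |l| + |l - <psi, k>| <= |psi| |k| }].
    - Every value satisfies the inequality ([ellipse_bound]).  Split off the
      components along [f]: [psi = <psi, f> f + psi'] and [k = <k, f> f + k'].
      Then [<psi, k> - l = <psi', k'>], so the left-hand side is
      [|<psi, f>| |<k, f>| + |<psi', k'>|].  Two applications of
      Cauchy-Schwarz, one in the Hilbert space and one in the plane, bound it
      by [|psi| |k|].
    - Every such [l] is a value ([ellipse_attained]).  In an orthonormal pair
      [e, g] with [e] parallel to [k] and [psi] in the span, and after scaling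
      [psi] and [k] to norm 1, one has to solve
      [m = x (a conj x + b conj y)] with [|x|^2 + |y|^2 = 1], where
      [a = <psi, e>] and [|a|^2 + b^2 = 1].  The number [t = |x|^2] has to be
      a root in [0, 1] of a real quadratic equation, whose discriminant is
      nonnegative because [|m| + |m - a| <= 1].  The second vector [g]
      exists even if [psi] is a multiple of [k], because the space has
      dimension at least 2.

    The ellipse has foci 0 and [<psi, k> = psi w].  If [k = c psi] its major
    axis equals the distance of the foci, and it degenerates to a segment; if
    [<psi, k> = 0] the foci coincide and it is a disk; otherwise strictness in
    Cauchy-Schwarz makes it a genuine ellipse.

    On the function side, the geometry takes place in the space of coefficient
    sequences.  The translation needs uniqueness of power series coefficients
    ([expansion_unique]), holomorphy of the sum of a power series on the disk
    ([expansion_holomorphic]) and the Taylor series of the kernel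
    ([kernel_expansion]), that is, of the principal logarithm. *)

(** * Complex series *)

Notation is_Cseries u l :=
  (is_series (K := C_AbsRing) (V := C_NormedModule) u l).

Lemma im_le_Cmod (z : C) : (Rabs (Im z) <= Cmod z)%R.
Proof. eapply Rle_trans; [apply Rmax_r | apply (Rmax_Cmod z)]. Qed.

Lemma sum_n_components (u : nat -> C) (n : nat) :
  sum_n (G := AbelianGroup.AbelianMonoid C_AbsRing) u n =
  (sum_n (fun k => Re (u k)) n, sum_n (fun k => Im (u k)) n).
Proof.
  induction n as [|n IH].
  - rewrite !sum_O. now destruct (u 0%nat).
  - rewrite !sum_Sn, IH. now destruct (u (S n)).
Qed.

Lemma is_Cseries_components (u : nat -> C) (l : C) :
  is_Cseries u l <->
  is_series (fun n => Re (u n)) (Re l) /\ is_series (fun n => Im (u n)) (Im l).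
Proof.
  unfold is_series. split.
  - intros H. split.
    + eapply filterlim_ext; [| eapply filterlim_comp; [exact H |]].
      * intros n. exact (f_equal fst (sum_n_components u n)).
      * destruct l as [x y]. exact (continuous_fst x y).
    + eapply filterlim_ext; [| eapply filterlim_comp; [exact H |]].
      * intros n. exact (f_equal snd (sum_n_components u n)).
      * destruct l as [x y]. exact (continuous_snd x y).
  - intros [H1 H2]. apply filterlim_locally. intros eps.
    generalize (filter_and _ _ (proj1 (filterlim_locally _ _) H1 eps)
                               (proj1 (filterlim_locally _ _) H2 eps)).
    apply filter_imp. intros n [A B].
    generalize (sum_n_components u n). intros E.
    change (ball (M := prod_UniformSpace R_UniformSpace R_UniformSpace) l eps
       (sum_n (G := AbelianGroup.AbelianMonoid C_AbsRing) u n)).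
    rewrite E. split; assumption.
Qed.

Lemma CSeries_unique (u : nat -> C) (l : C) : is_Cseries u l -> CSeries u = l.
Proof.
  intros H. apply is_Cseries_components in H. destruct H as [A B].
  unfold CSeries. rewrite (is_series_unique _ _ A), (is_series_unique _ _ B).
  now destruct l.
Qed.

Lemma ex_series_comparison (u v : nat -> R) :
  (forall n, (Rabs (u n) <= v n)%R) -> ex_series v -> ex_series u.
Proof. apply (ex_series_le (K := R_AbsRing) (V := R_CompleteNormedModule)). Qed.

Lemma is_Cseries_CSeries (u : nat -> C) :
  ex_series (fun n => Cmod (u n)) -> is_Cseries u (CSeries u).
Proof.
  intros H. apply is_Cseries_components.
  split; apply Series_correct; apply (ex_series_comparison _ _) with (2 := H);
    intros n.
  - apply re_le_Cmod.
  - apply im_le_Cmod.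
Qed.

Lemma is_Cseries_ext (u v : nat -> C) (l : C) :
  (forall n, u n = v n) -> is_Cseries u l -> is_Cseries v l.
Proof. apply is_series_ext. Qed.

Lemma is_Cseries_plus (u v : nat -> C) (k l : C) :
  is_Cseries u k -> is_Cseries v l -> is_Cseries (fun n => u n + v n) (k + l).
Proof. apply (is_series_plus (V := C_NormedModule)). Qed.

Lemma is_Cseries_scal (c : C) (u : nat -> C) (l : C) :
  is_Cseries u l -> is_Cseries (fun n => c * u n) (c * l).
Proof. apply (is_series_scal (V := C_NormedModule)). Qed.

Lemma real_series_scal (c : R) (v : nat -> R) (s : R) :
  is_series v s -> is_series (fun n => c * v n)%R (c * s)%R.
Proof. apply (is_series_scal (K := R_AbsRing) (V := R_NormedModule)). Qed.

Lemma Cmod_series_le (u : nat -> C) (l : C) (v : nat -> R) (s : R) :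
  is_Cseries u l -> is_series v s -> (forall n, (Cmod (u n) <= v n)%R) ->
  (Cmod l <= s)%R.
Proof.
  intros Hu Hv H.
  apply (is_lim_seq_le
    (fun n => Cmod (sum_n (G := AbelianGroup.AbelianMonoid C_AbsRing) u n))
    (sum_n v) (Cmod l) s).
  - intros n. eapply Rle_trans.
    + exact (norm_sum_n_m (K := C_AbsRing) (V := C_NormedModule) u 0 n).
    + apply sum_n_m_le. exact H.
  - eapply filterlim_comp; [exact Hu |].
    exact (filterlim_norm (K := C_AbsRing) (V := C_NormedModule) l).
  - exact Hv.
Qed.

Lemma series_term_le (v : nat -> R) (s : R) (k : nat) :
  is_series v s -> (forall n, (0 <= v n)%R) -> (v k <= s)%R.
Proof.
  intros Hv H.
  assert (pos : forall n, (0 <= sum_n v n)%R).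
  { induction n as [|n IH]; [rewrite sum_O; apply H|].
    rewrite sum_Sn. apply Rplus_le_le_0_compat; [exact IH | apply H]. }
  apply (is_lim_seq_le_loc (fun _ => v k) (sum_n v) (v k) s).
  - exists k. intros n Hn.
    induction Hn as [|n Hn IH].
    + destruct k as [|k]; [rewrite sum_O; apply Rle_refl|].
      rewrite sum_Sn. generalize (pos k). unfold plus; simpl. lra.
    + rewrite sum_Sn. generalize (H (S n)). unfold plus; simpl. lra.
  - apply is_lim_seq_const.
  - exact Hv.
Qed.

Lemma pow_n_Cpow (z : C) (n : nat) : pow_n (K := C_AbsRing) z n = z ^ n.
Proof. induction n as [|n IH]; [reflexivity|]. simpl. now rewrite IH. Qed.

(** With [Cpow] in place of [pow_n], [ring] applies to the terms. *)
Lemma expansion_Cpow (f : C -> C) (a : nat -> C) :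
  expansion f a <->
  forall z, unit_disk z -> is_Cseries (fun n => z ^ n * a n) (f z).
Proof.
  unfold expansion, is_pseries.
  split; intros H z Hz; generalize (H z Hz); apply is_Cseries_ext; intros n;
    [|symmetry]; exact (f_equal (fun v => v * a n) (pow_n_Cpow z n)).
Qed.

(** * Uniqueness of power series coefficients *)

Lemma Re_real_pow (x : R) (n : nat) (c : C) :
  Re (RtoC x ^ n * c) = (Re c * x ^ n)%R.
Proof. rewrite <- RtoC_pow, re_scal_l. ring. Qed.

Lemma Im_real_pow (x : R) (n : nat) (c : C) :
  Im (RtoC x ^ n * c) = (Im c * x ^ n)%R.
Proof. rewrite <- RtoC_pow, im_scal_l. ring. Qed.

Lemma CV_radius_pos (a : nat -> R) (x : R) :
  (0 < x)%R -> ex_series (fun n => a n * x ^ n)%R -> Rbar_lt 0 (CV_radius a).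
Proof.
  intros Hx H.
  destruct (Rbar_lt_le_dec (CV_radius a) (Rabs x)) as [L|L].
  - exfalso. apply (CV_disk_outside _ _ L). now apply ex_series_lim_0.
  - eapply Rbar_lt_le_trans; [|exact L]. simpl. now apply Rabs_pos_lt, Rgt_not_eq.
Qed.

Lemma real_pseries_unique (a b : nat -> R) (f : R -> R) :
  (forall x, (Rabs x < 1)%R -> is_series (fun n => a n * x ^ n)%R (f x)) ->
  (forall x, (Rabs x < 1)%R -> is_series (fun n => b n * x ^ n)%R (f x)) ->
  forall n, a n = b n.
Proof.
  intros Ha Hb n.
  assert (H2 : (Rabs (/ 2) < 1)%R) by (rewrite Rabs_pos_eq; lra).
  apply PSeries_ext_recip.
  - apply (CV_radius_pos a (/ 2)); [lra | eexists; now apply Ha].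
  - apply (CV_radius_pos b (/ 2)); [lra | eexists; now apply Hb].
  - exists (mkposreal 1 Rlt_0_1). intros x Hx.
    assert (Hx' : (Rabs x < 1)%R).
    { replace x with (minus x 0) by (unfold minus, plus, opp; simpl; ring).
      exact Hx. }
    unfold PSeries. rewrite (is_series_unique _ _ (Ha x Hx')).
    now rewrite (is_series_unique _ _ (Hb x Hx')).
Qed.

(** Restricted to the real points of the disk, the real and imaginary parts of
    an expansion are real power series, whose coefficients are unique. *)
Lemma expansion_unique (f : C -> C) (a b : nat -> C) :
  expansion f a -> expansion f b -> a = b.
Proof.
  intros Ha Hb. rewrite expansion_Cpow in Ha, Hb.
  assert (D : forall x, (Rabs x < 1)%R -> unit_disk (RtoC x)).
  { intros x Hx. unfold unit_disk. now rewrite Cmod_R. }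
  apply functional_extensionality. intros n.
  apply injective_projections.
  - apply (real_pseries_unique (fun n => Re (a n)) (fun n => Re (b n))
             (fun x => Re (f (RtoC x)))); intros x Hx.
    + generalize (proj1 (proj1 (is_Cseries_components _ _) (Ha _ (D x Hx)))).
      apply is_series_ext. intros k. apply Re_real_pow.
    + generalize (proj1 (proj1 (is_Cseries_components _ _) (Hb _ (D x Hx)))).
      apply is_series_ext. intros k. apply Re_real_pow.
  - apply (real_pseries_unique (fun n => Im (a n)) (fun n => Im (b n))
             (fun x => Im (f (RtoC x)))); intros x Hx.
    + generalize (proj2 (proj1 (is_Cseries_components _ _) (Ha _ (D x Hx)))).
      apply is_series_ext. intros k. apply Im_real_pow.
    + generalize (proj2 (proj1 (is_Cseries_components _ _) (Hb _ (D x Hx)))).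
      apply is_series_ext. intros k. apply Im_real_pow.
Qed.

Lemma expansion_eq_on_disk (f g : C -> C) (a : nat -> C) :
  eq_on_disk f g -> expansion f a -> expansion g a.
Proof. intros E H z Hz. rewrite <- (E z Hz). now apply H. Qed.

(** [coef f] is chosen among the expansions of [f], of which there is only one. *)
Lemma coef_expansion (f : C -> C) (a : nat -> C) :
  expansion f a -> coef f = a.
Proof.
  intros H. apply (expansion_unique f); [|exact H].
  unfold coef. apply epsilon_spec. now exists a.
Qed.

(** * Sums of power series are holomorphic *)

(** By induction on [n]: the remainder [D n] satisfies
    [D (S n) = (z + h) D n + n z^(n-1) h^2].  The factor [n^2] is a crude bound
    of the sharp [n (n - 1) / 2], and [/ rho^2] replaces the exponent [n - 2]. *)
Lemma remainder_bound (z h : C) (rho : R) (n : nat) :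
  (0 < rho)%R -> (Cmod z <= rho)%R -> (Cmod (z + h) <= rho)%R ->
  (Cmod ((z + h) ^ n - z ^ n - RtoC (INR n) * z ^ pred n * h)
   <= INR n ^ 2 * rho ^ n / rho ^ 2 * Cmod h ^ 2)%R.
Proof.
  intros Hr Hz Hzh.
  induction n as [|n IH].
  - simpl. replace (1 - 1 - 0 * 1 * h) with (RtoC 0) by ring.
    rewrite Cmod_0. right. field. lra.
  - replace ((z + h) ^ S n - z ^ S n - RtoC (INR (S n)) * z ^ pred (S n) * h)
      with ((z + h) * ((z + h) ^ n - z ^ n - RtoC (INR n) * z ^ pred n * h)
            + RtoC (INR n) * z ^ pred n * (h * h)).
    2:{ rewrite S_INR, RtoC_plus. destruct n as [|n].
        - simpl. ring.
        - simpl pred. rewrite !Cpow_S. ring. }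
    eapply Rle_trans; [apply Cmod_triangle|].
    rewrite !Cmod_mult, Cmod_pow, Cmod_R, (Rabs_pos_eq _ (pos_INR n)).
    assert (HN : (0 <= INR n)%R) by apply pos_INR.
    assert (A : (INR n * Cmod z ^ pred n <= INR n * rho ^ n / rho)%R).
    { destruct n as [|n]; [simpl; right; field; lra|].
      simpl pred. unfold Rdiv. rewrite Rmult_assoc.
      apply Rmult_le_compat_l; [exact HN|].
      replace (rho ^ S n * / rho)%R with (rho ^ n)%R by (simpl; field; lra).
      apply pow_incr. split; [apply Cmod_ge_0 | exact Hz]. }
    assert (Hh : (0 <= Cmod h)%R) by apply Cmod_ge_0.
    assert (B := Rmult_le_compat _ _ _ _ (Cmod_ge_0 (z + h))
                   (Cmod_ge_0 _) Hzh IH).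
    assert (D : (INR n * Cmod z ^ pred n * (Cmod h * Cmod h)
                 <= INR n * rho ^ n / rho * (Cmod h * Cmod h))%R).
    { apply Rmult_le_compat_r; [nra | exact A]. }
    eapply Rle_trans; [apply Rplus_le_compat; [exact B | exact D]|].
    rewrite S_INR.
    assert (Hp : (0 <= rho ^ n / rho * Cmod h ^ 2)%R).
    { apply Rmult_le_pos; [|nra]. apply Rle_mult_inv_pos; [apply pow_le|]; lra. }
    replace (rho * (INR n ^ 2 * rho ^ n / rho ^ 2 * Cmod h ^ 2) +
             INR n * rho ^ n / rho * (Cmod h * Cmod h))%R
      with ((INR n ^ 2 + INR n) * (rho ^ n / rho * Cmod h ^ 2))%R
      by (field; lra).
    replace ((INR n + 1) ^ 2 * rho ^ S n / rho ^ 2 * Cmod h ^ 2)%R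
      with ((INR n + 1) ^ 2 * (rho ^ n / rho * Cmod h ^ 2))%R
      by (simpl; field; lra).
    apply Rmult_le_compat_r; [exact Hp | nra].
Qed.

Lemma ex_series_sqr_geom (q : R) :
  (0 < q < 1)%R -> ex_series (fun n => INR (S n) ^ 2 * q ^ n)%R.
Proof.
  intros Hq.
  assert (HS : forall n, (0 < INR (S n))%R) by (intros n; apply lt_0_INR; lia).
  assert (Hp : forall n, (0 < INR (S n) ^ 2 * q ^ n)%R).
  { intros n. apply Rmult_lt_0_compat; apply pow_lt; [apply HS | lra]. }
  apply (ex_series_ext (fun n => Rabs (INR (S n) ^ 2 * q ^ n))).
  { intros n. apply Rabs_pos_eq, Rlt_le, Hp. }
  apply (ex_series_DAlembert _ q); [lra | intros n; apply Rgt_not_eq, Hp |].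
  apply (is_lim_seq_ext (fun n => (1 + / INR (S n)) * (1 + / INR (S n)) * q)%R).
  { intros n. rewrite Rabs_pos_eq.
    - rewrite (S_INR (S n)). generalize (HS n). generalize (INR (S n)).
      intros N HN. simpl pow. field. repeat split; try apply pow_nonzero; lra.
    - apply Rle_mult_inv_pos; [apply Rlt_le|]; apply Hp. }
  assert (L : is_lim_seq (fun n => 1 + / INR (S n))%R 1).
  { replace (Finite 1) with (Finite (1 + 0)) by (f_equal; ring).
    apply is_lim_seq_plus'; [apply is_lim_seq_const|].
    replace (Finite 0) with (Rbar_inv p_infty) by reflexivity.
    apply is_lim_seq_inv; [|discriminate].
    apply (is_lim_seq_incr_1 INR), is_lim_seq_INR. }
  replace (Finite q) with (Finite (1 * 1 * q)) by (f_equal; ring).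
  apply is_lim_seq_mult'; [apply is_lim_seq_mult'; exact L |].
  apply is_lim_seq_const.
Qed.

Lemma is_Cseries_bounded (u : nat -> C) (l : C) :
  is_Cseries u l -> exists M, (0 <= M)%R /\ forall n, (Cmod (u n) <= M)%R.
Proof.
  intros H. apply is_Cseries_components in H. destruct H as [A B].
  assert (bdd : forall v : nat -> R, ex_series v ->
                exists M, forall n, (Rabs (v n) <= M)%R).
  { intros v Hv. destruct (filterlim_bounded v) as [M HM].
    - exists (0%R). exact (ex_series_lim_0 v Hv).
    - now exists M. }
  destruct (bdd _ (ex_intro _ _ A)) as [M1 H1].
  destruct (bdd _ (ex_intro _ _ B)) as [M2 H2].
  assert (P1 := Rle_trans _ _ _ (Rabs_pos _) (H1 0%nat)).
  assert (P2 := Rle_trans _ _ _ (Rabs_pos _) (H2 0%nat)).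
  exists (M1 + M2)%R. split; [lra|]. intros n.
  replace (u n) with (RtoC (Re (u n)) + Ci * RtoC (Im (u n))).
  2:{ destruct (u n) as [x y]. unfold Ci. cbn. apply injective_projections; simpl; ring. }
  eapply Rle_trans; [apply Cmod_triangle|].
  rewrite Cmod_mult, Cmod_Ci, !Cmod_R, Rmult_1_l.
  apply Rplus_le_compat; auto.
Qed.

(** Differentiation term by term.  With [|z| < rho < r < 1], convergence at [r]
    bounds [|a n| rho^n] by a multiple of [(rho / r)^n].  The remainders then
    sum to at most a constant times [|h|^2]. *)
Lemma expansion_holomorphic (f : C -> C) (a : nat -> C) :
  expansion f a -> holomorphic_on_disk f.
Proof.
  rewrite expansion_Cpow. intros Hf z Hz.
  unfold unit_disk in Hz.
  assert (Hz0 := Cmod_ge_0 z).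
  set (r := ((2 + Cmod z) / 3)%R).
  set (rho := ((1 + 2 * Cmod z) / 3)%R).
  assert (Hr : (Cmod z < rho < r /\ 0 < rho /\ r < 1)%R) by (unfold r, rho; lra).
  destruct Hr as [[Hr1 Hr2] [Hr3 Hr4]]. clearbody r rho.
  assert (Dr : unit_disk (RtoC r)).
  { unfold unit_disk. rewrite Cmod_R, Rabs_pos_eq; lra. }
  destruct (is_Cseries_bounded _ _ (Hf _ Dr)) as [M [HM0 HM]].
  assert (Ha : forall n, (Cmod (a n) * r ^ n <= M)%R).
  { intros n. generalize (HM n).
    rewrite Cmod_mult, Cmod_pow, Cmod_R, Rabs_pos_eq by lra. lra. }
  set (q := (rho / r)%R).
  assert (Hq : (0 < q < 1)%R).
  { unfold q. split; [apply Rdiv_lt_0_compat; lra|].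
    apply Rmult_lt_reg_r with r; [lra|]. unfold Rdiv.
    rewrite Rmult_assoc, Rinv_l; lra. }
  assert (Han : forall n, (Cmod (a n) * rho ^ n <= M * q ^ n)%R).
  { intros n. unfold q.
    replace (Cmod (a n) * rho ^ n)%R with (Cmod (a n) * r ^ n * (rho / r) ^ n)%R.
    - apply Rmult_le_compat_r; [|apply Ha]. apply pow_le, Rlt_le, Hq.
    - unfold Rdiv. rewrite Rpow_mult_distr, pow_inv. field.
      apply pow_nonzero; lra. }
  assert (Sq := ex_series_sqr_geom q Hq).
  destruct Sq as [T HT].
  assert (Hpos : forall n, (0 <= INR (S n) ^ 2 * q ^ n)%R).
  { intros n. apply Rmult_le_pos; [apply pow2_ge_0 | apply pow_le; lra]. }
  assert (HSpos : (0 <= T)%R).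
  { apply (Rle_trans _ _ _ (Hpos 0%nat) (series_term_le _ _ 0 HT Hpos)). }
  assert (Hnn : forall n, (0 <= INR n)%R) by apply pos_INR.
  assert (Hn2 : forall n, (INR n <= INR (S n) ^ 2 /\ INR n ^ 2 <= INR (S n) ^ 2)%R).
  { intros n. rewrite S_INR. generalize (Hnn n). intros; nra. }
  set (d := fun n => RtoC (INR n) * z ^ pred n * a n).
  assert (Hd : ex_series (fun n => Cmod (d n))).
  { apply (ex_series_comparison _
       (fun n => M / rho * (INR (S n) ^ 2 * q ^ n))%R).
    2:{ exists (M / rho * T)%R. now apply real_series_scal. }
    intros n. rewrite (Rabs_pos_eq _ (Cmod_ge_0 _)). unfold d.
    rewrite !Cmod_mult, Cmod_pow, Cmod_R, (Rabs_pos_eq _ (Hnn n)).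
    apply Rle_trans with (INR n * (Cmod (a n) * rho ^ n) / rho)%R.
    - destruct n as [|n]; [simpl; right; field; lra|].
      simpl pred.
      replace (INR (S n) * (Cmod (a (S n)) * rho ^ S n) / rho)%R
       with (INR (S n) * rho ^ n * Cmod (a (S n)))%R by (simpl pow; field; lra).
      apply Rmult_le_compat_r; [apply Cmod_ge_0|].
      apply Rmult_le_compat_l; [apply Hnn|].
      apply pow_incr; lra.
    - apply Rle_trans with (INR n * (M * q ^ n) / rho)%R.
      + unfold Rdiv. apply Rmult_le_compat_r; [apply Rlt_le, Rinv_0_lt_compat; lra|].
        apply Rmult_le_compat_l; [apply Hnn | apply Han].
      + replace (M / rho * (INR (S n) ^ 2 * q ^ n))%R with
         ((INR (S n))^2 * (M * q^n) / rho)%R by (field; lra).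
        unfold Rdiv. apply Rmult_le_compat_r; [apply Rlt_le, Rinv_0_lt_compat; lra|].
        apply Rmult_le_compat_r; [|apply Hn2].
        apply Rmult_le_pos; [exact HM0 | apply pow_le; lra]. }
  apply is_Cseries_CSeries in Hd. set (D := CSeries d) in Hd.
  set (K := (M / rho ^ 2 * T)%R).
  assert (HK : (0 <= K)%R).
  { apply Rmult_le_pos; [|exact HSpos]. apply Rle_mult_inv_pos; [exact HM0|].
    apply pow_lt; lra. }
  assert (Main : forall y, (Cmod (y - z) < rho - Cmod z)%R ->
    (Cmod (f y - f z - (y - z) * D) <= K * Cmod (y - z) ^ 2)%R).
  { intros y Hy. set (h := y - z).
    assert (Ey : y = z + h) by (unfold h; ring).
    assert (Hy' : (Cmod (z + h) <= rho)%R).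
    { eapply Rle_trans; [apply Cmod_triangle|]. unfold h. lra. }
    assert (Dy : unit_disk y) by (unfold unit_disk; rewrite Ey; lra).
    replace (f y - f z - h * D) with (f y + ((- (1)) * f z + (- h) * D)) by ring.
    apply (Cmod_series_le (fun n => y ^ n * a n + ((- (1)) * (z ^ n * a n) + (- h) * d n)) _
      (fun n => M / rho ^ 2 * Cmod h ^ 2 * (INR (S n) ^ 2 * q ^ n))%R).
    - apply is_Cseries_plus; [now apply Hf|].
      apply is_Cseries_plus; apply is_Cseries_scal; [apply Hf; exact Hz | exact Hd].
    - replace (K * Cmod h ^ 2)%R with (M / rho ^ 2 * Cmod h ^ 2 * T)%R
        by (unfold K; field; lra).
      now apply real_series_scal.
    - intros n. unfold d.
      replace (y ^ n * a n +
         ((- (1)) * (z ^ n * a n) + - h * (RtoC (INR n) * z ^ pred n * a n)))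
        with (((z + h) ^ n - z ^ n - RtoC (INR n) * z ^ pred n * h) * a n)
        by (rewrite Ey; ring).
      rewrite Cmod_mult.
      eapply Rle_trans.
      + apply Rmult_le_compat_r; [apply Cmod_ge_0|].
        apply (remainder_bound z h rho n); lra.
      + replace (INR n ^ 2 * rho ^ n / rho ^ 2 * Cmod h ^ 2 * Cmod (a n))%R
          with (INR n ^ 2 * (/ rho ^ 2 * Cmod h ^ 2 * (Cmod (a n) * rho ^ n)))%R
          by (field; lra).
        replace (M / rho ^ 2 * Cmod h ^ 2 * (INR (S n) ^ 2 * q ^ n))%R
          with (INR (S n) ^ 2 * (/ rho ^ 2 * Cmod h ^ 2 * (M * q ^ n)))%R
          by (field; lra).
        assert (P : (0 <= / rho ^ 2 * Cmod h ^ 2)%R).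
        { apply Rmult_le_pos; [|apply pow2_ge_0].
          apply Rlt_le, Rinv_0_lt_compat, pow_lt; lra. }
        apply Rmult_le_compat; [apply pow2_ge_0 | | apply Hn2 |].
        * apply Rmult_le_pos; [exact P|].
          apply Rmult_le_pos; [apply Cmod_ge_0 | apply pow_le; lra].
        * apply Rmult_le_compat_l; [exact P | apply Han]. }
  exists D. split; [apply (is_linear_scal_l (K := C_AbsRing) (V := C_NormedModule))|].
  intros x Hx.
  assert (Ex := is_filter_lim_locally_unique (K := C_AbsRing)
     (V := AbsRing_NormedModule C_AbsRing) _ _ Hx).
  subst x. intros eps.
  assert (Hdel : (0 < Rmin (rho - Cmod z) (eps / (K + 1)))%R).
  { apply Rmin_pos; [lra|]. apply Rdiv_lt_0_compat; [apply cond_pos | lra]. }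
  exists (mkposreal _ Hdel). intros y Hy.
  change (Cmod (y - z) < Rmin (rho - Cmod z) (eps / (K + 1)))%R in Hy.
  change (Cmod (f y - f z - (y - z) * D) <= eps * Cmod (y - z))%R.
  assert (H1 := Rlt_le_trans _ _ _ Hy (Rmin_l _ _)).
  assert (H2 := Rlt_le_trans _ _ _ Hy (Rmin_r _ _)).
  eapply Rle_trans; [apply Main; exact H1|].
  replace (K * Cmod (y - z) ^ 2)%R with (K * Cmod (y - z) * Cmod (y - z))%R by ring.
  apply Rmult_le_compat_r; [apply Cmod_ge_0|].
  apply Rmult_lt_compat_r with (r := (K + 1)%R) in H2; [|lra].
  unfold Rdiv in H2. rewrite Rmult_assoc, Rinv_l in H2 by lra.
  assert (H3 := Cmod_ge_0 (y - z)). nra.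
Qed.

(** * The Taylor series of the kernel *)

(** The sum [T] exists by absolute convergence, and splitting off the first
    term gives [T = v T + 1]. *)
Lemma is_Cseries_geom (v : C) :
  (Cmod v < 1)%R -> is_Cseries (fun n => v ^ n) (/ (1 - v)).
Proof.
  intros Hv.
  assert (H1 : 1 - v <> 0).
  { intros E. apply (Rlt_irrefl 1). rewrite <- Cmod_1 at 1.
    replace (RtoC 1) with (1 - v + v) by ring. rewrite E.
    now replace (0 + v) with v by ring. }
  assert (H : is_Cseries (fun n => v ^ n) (CSeries (fun n => v ^ n))).
  { apply is_Cseries_CSeries. apply (ex_series_ext (fun n => Cmod v ^ n)%R).
    - intros n. symmetry. apply Cmod_pow.
    - apply ex_series_geom. now rewrite (Rabs_pos_eq _ (Cmod_ge_0 v)). }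
  set (T := CSeries _) in H.
  assert (E : T = v * T + 1).
  { apply CSeries_unique.
    apply (is_series_decr_1 (V := C_NormedModule) (fun n => v ^ n)).
    replace (plus _ _) with (v * T); [exact (is_Cseries_scal v _ _ H)|].
    change (v * T = v * T + 1 + - (1)). ring. }
  replace (/ (1 - v)) with T; [exact H|].
  assert (E' : (1 - v) * T = 1).
  { replace ((1 - v) * T) with (T - v * T) by ring. rewrite E at 1. ring. }
  apply (f_equal (Cmult (/ (1 - v)))) in E'.
  rewrite Cmult_assoc, Cinv_l, Cmult_1_l, Cmult_1_r in E'; assumption.
Qed.

(** Term-by-term integration up to 1, which lies inside the disk of convergence. *)
Lemma is_series_integrated (b : nat -> R) (G : R -> R) :
  Rbar_lt 1 (CV_radius b) ->
  (forall t, (0 <= t <= 1)%R -> is_derive G t (PSeries b t)) ->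
  is_series (fun n => b n / INR (S n))%R (G 1 - G 0)%R.
Proof.
  intros Hb HG.
  assert (Hin : forall t, (0 <= t <= 1)%R -> Rbar_lt (Rabs t) (CV_radius b)).
  { intros t Ht. eapply Rbar_le_lt_trans; [|exact Hb]. simpl.
    rewrite Rabs_pos_eq; lra. }
  assert (I : is_RInt (PSeries b) 0 1 (G 1 - G 0)%R).
  { apply (is_RInt_derive (V := R_CompleteNormedModule) G).
    - intros t. rewrite Rmin_left, Rmax_right by lra. apply HG.
    - intros t. rewrite Rmin_left, Rmax_right by lra. intros Ht.
      apply continuity_pt_filterlim, PSeries_continuity, Hin, Ht. }
  assert (P : is_pseries (PS_Int b) 1 (G 1 - G 0)%R).
  { rewrite <- (is_RInt_unique _ _ _ _ I). apply is_pseries_RInt, Hin. lra. }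
  apply is_pseries_R in P.
  apply (is_series_ext (fun n => PS_Int b (S n) * 1 ^ S n)%R).
  { intros n. rewrite pow1. apply Rmult_1_r. }
  apply (is_series_incr_1 (fun n => PS_Int b n * 1 ^ n)%R).
  simpl PS_Int. replace (plus _ _) with (G 1 - G 0)%R; [exact P|].
  unfold plus; simpl. ring.
Qed.

(** The terms stay bounded at the point [2 / (1 + |u|)], which exceeds 1 and
    whose product with [|u|] is at most 1; unlike [1 / |u|], it is also defined
    for [u = 0]. *)
Lemma CV_radius_gt_1 (u : C) (b : nat -> R) :
  (Cmod u < 1)%R -> (forall n, (Rabs (b n) <= Cmod (u ^ S n))%R) ->
  Rbar_lt 1 (CV_radius b).
Proof.
  intros Hu Hb. assert (H0 := Cmod_ge_0 u).
  set (r := (2 / (1 + Cmod u))%R).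
  assert (Er : (r * (1 + Cmod u) = 2)%R) by (unfold r; field; lra).
  assert (Hr : (1 < r)%R) by nra.
  apply (Rbar_lt_le_trans _ r); [exact Hr|].
  apply (proj1 (CV_radius_bounded b)). exists 1%R. intros n.
  rewrite Rabs_mult, <- RPow_abs, (Rabs_pos_eq r) by lra.
  apply Rle_trans with (Cmod (u ^ S n) * r ^ n)%R.
  { apply Rmult_le_compat_r; [apply pow_le; lra | apply Hb]. }
  rewrite Cmod_pow. simpl. rewrite Rmult_assoc, <- Rpow_mult_distr.
  assert (P : (0 <= Cmod u * r <= 1)%R) by (split; nra).
  assert (Q : (0 <= (Cmod u * r) ^ n)%R) by (apply pow_le; lra).
  assert (Q' : ((Cmod u * r) ^ n <= 1 ^ n)%R) by (apply pow_incr; lra).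
  rewrite pow1 in Q'. nra.
Qed.

Lemma disk_re (u : C) : (Cmod u < 1)%R -> (-1 < Re u < 1)%R.
Proof.
  intros H. generalize (re_le_Cmod u). intros P. apply Rabs_le_between in P. lra.
Qed.

(** Real and imaginary parts of [u / (1 - t u)], the derivative of
    [- log (1 - t u)] in [t]. *)
Lemma PSeries_geom (u : C) (t : R) :
  (Cmod u < 1)%R -> (0 <= t <= 1)%R ->
  let den := ((1 - t * Re u) ^ 2 + (t * Im u) ^ 2)%R in
  PSeries (fun n => Re (u ^ S n)) t =
    ((Re u * (1 - t * Re u) - t * Im u ^ 2) / den)%R /\
  PSeries (fun n => Im (u ^ S n)) t = (Im u / den)%R.
Proof.
  intros Hu Ht den.
  assert (Hpos : (0 < 1 - t * Re u)%R).
  { generalize (disk_re u Hu). intros. nra. }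
  assert (Hden : (0 < den)%R).
  { unfold den. generalize (pow2_ge_0 (t * Im u)). intros. nra. }
  assert (Htu : (Cmod (RtoC t * u) < 1)%R).
  { rewrite Cmod_mult, Cmod_R, Rabs_pos_eq by lra.
    generalize (Cmod_ge_0 u). intros. nra. }
  assert (G := is_Cseries_scal u _ _ (is_Cseries_geom _ Htu)).
  apply is_Cseries_components in G. destruct G as [G1 G2].
  assert (E : u * / (1 - RtoC t * u) =
    (((Re u * (1 - t * Re u) - t * Im u ^ 2) / den)%R, (Im u / den)%R)).
  { destruct u as [x y]. unfold den in *; simpl in *.
    apply injective_projections; simpl; field;
    apply Rgt_not_eq; nra. }
  rewrite E in G1, G2.
  assert (Epow : forall n, u * (RtoC t * u) ^ n = RtoC t ^ n * u ^ S n).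
  { intros n. rewrite Cpow_mult_l, Cpow_S. ring. }
  split; apply is_series_unique.
  - eapply is_series_ext; [|exact G1]. intros n. cbv beta.
    rewrite Epow. apply Re_real_pow.
  - eapply is_series_ext; [|exact G2]. intros n. cbv beta.
    rewrite Epow. apply Im_real_pow.
Qed.

(** In the right half-plane the argument is an arctangent, which, unlike
    [acos], can be differentiated across the real axis. *)
Lemma Carg_atan (v : C) : (0 < Re v)%R -> Carg v = atan (Im v / Re v).
Proof.
  intros Hp. destruct v as [p q]. unfold Carg. simpl in *.
  set (m := Cmod (p, q)).
  assert (Hm : (0 < m)%R).
  { unfold m. apply Cmod_gt_0. intros E. injection E. lra. }
  assert (Em : (m ^ 2 = p ^ 2 + q ^ 2)%R) by (apply (Cmod2_alt (p, q))).
  assert (A : acos (p / m) = atan (Rabs q / p)).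
  { rewrite acos_atan by (now apply Rdiv_lt_0_compat).
    f_equal. replace (1 - (p / m)²)%R with ((Rabs q / m) ^ 2)%R.
    - rewrite <- Rsqr_pow2, sqrt_Rsqr; [field; lra|].
      apply Rle_mult_inv_pos; [apply Rabs_pos | exact Hm].
    - unfold Rdiv. rewrite Rpow_mult_distr, pow2_abs. unfold Rsqr.
      replace (q ^ 2)%R with (m ^ 2 - p ^ 2)%R by lra. field. lra. }
  rewrite A. destruct (Rle_dec 0 q) as [Q|Q].
  - now rewrite Rabs_pos_eq.
  - rewrite Rabs_left by lra. rewrite <- atan_opp. f_equal. field. lra.
Qed.

(** Both parts of the principal logarithm of [1 / (1 - t u)] are primitives in
    the real variable [t] of a geometric series: the real part is
    [- 1/2 ln |1 - t u|^2], and the imaginary part is an arctangent, because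
    [1 - t u] remains in the right half-plane. *)
Lemma is_Cseries_Clog (u : C) :
  (Cmod u < 1)%R ->
  is_Cseries (fun n => u ^ S n / RtoC (INR (S n))) (Clog (/ (1 - u))).
Proof.
  intros Hu.
  assert (Hre := disk_re u Hu).
  assert (HS : forall n, (0 < INR (S n))%R) by (intros n; apply lt_0_INR; lia).
  assert (Hpos : forall t, (0 <= t <= 1)%R -> (0 < 1 - t * Re u)%R)
    by (intros; nra).
  assert (Hden : forall t, (0 <= t <= 1)%R ->
                 (0 < (1 - t * Re u) ^ 2 + (t * Im u) ^ 2)%R).
  { intros t Ht. generalize (Hpos t Ht), (pow2_ge_0 (t * Im u)). intros. nra. }
  assert (H1 : 1 - u <> 0).
  { intros E. apply (f_equal fst) in E. simpl in E. unfold Re in Hre. lra. }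
  apply is_Cseries_components. split.
  - set (G := fun t => (- / 2 * ln ((1 - t * Re u) ^ 2 + (t * Im u) ^ 2))%R).
    replace (Re (Clog (/ (1 - u)))) with (G 1 - G 0)%R.
    + apply (is_series_ext (fun n => Re (u ^ S n) / INR (S n))%R).
      { intros n. unfold Cdiv, Rdiv.
        rewrite <- RtoC_inv by (apply Rgt_not_eq, HS). now rewrite re_scal_r. }
      apply is_series_integrated.
      * apply (CV_radius_gt_1 u); [exact Hu|]. intros n. apply re_le_Cmod.
      * intros t Ht. rewrite (proj1 (PSeries_geom u t Hu Ht)). unfold G.
        generalize (Hden t Ht). intros D. auto_derive; [lra|].
        field. lra.
    + unfold G. simpl Re.
      replace ((1 - 0 * Re u) ^ 2 + (0 * Im u) ^ 2)%R with 1%R by ring.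
      rewrite ln_1, Cmod_inv by exact H1.
      rewrite ln_Rinv by (now apply Cmod_gt_0).
      replace ((1 - 1 * Re u) ^ 2 + (1 * Im u) ^ 2)%R with (Cmod (1 - u) ^ 2)%R.
      * replace (Cmod (1 - u) ^ 2)%R with (Cmod (1 - u) * Cmod (1 - u))%R by ring.
        rewrite ln_mult by (now apply Cmod_gt_0). field.
      * rewrite Cmod2_alt. destruct u. simpl. ring.
  - set (G := fun t => atan (t * Im u / (1 - t * Re u))).
    replace (Im (Clog (/ (1 - u)))) with (G 1 - G 0)%R.
    + apply (is_series_ext (fun n => Im (u ^ S n) / INR (S n))%R).
      { intros n. unfold Cdiv, Rdiv.
        rewrite <- RtoC_inv by (apply Rgt_not_eq, HS). now rewrite im_scal_r. }
      apply is_series_integrated.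
      * apply (CV_radius_gt_1 u); [exact Hu|]. intros n. apply im_le_Cmod.
      * intros t Ht. rewrite (proj2 (PSeries_geom u t Hu Ht)). unfold G.
        generalize (Hpos t Ht) (Hden t Ht). intros D D'. auto_derive; [lra|].
        unfold Rsqr. field. repeat split; lra.
    + unfold G. replace (0 * Im u / (1 - 0 * Re u))%R with 0%R by field.
      rewrite atan_0, Rminus_0_r. simpl Im.
      assert (HR := Hpos 1%R ltac:(lra)). assert (HD := Hden 1%R ltac:(lra)).
      destruct u as [x y]. simpl in HR, HD.
      rewrite Carg_atan.
      * f_equal. simpl. field. split; nra.
      * simpl. apply Rdiv_lt_0_compat; nra.
Qed.

Lemma kernel_expansion (w : C) :
  (Cmod w < 1)%R ->
  expansion (kernel w) (fun n => Cconj w ^ n / RtoC (INR (S n))).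
Proof.
  intros Hw. apply expansion_Cpow. intros z Hz. unfold unit_disk in Hz.
  assert (HS : forall n, RtoC (INR (S n)) <> 0).
  { intros n E. apply RtoC_inj in E. revert E. apply not_0_INR. lia. }
  set (u := z * Cconj w).
  assert (Hu : (Cmod u < 1)%R).
  { unfold u. rewrite Cmod_mult, Cmod_conj.
    generalize (Cmod_ge_0 z) (Cmod_ge_0 w). intros. nra. }
  apply (is_Cseries_ext (fun n => u ^ n / RtoC (INR (S n)))).
  { intros n. unfold u. rewrite Cpow_mult_l. field. apply HS. }
  assert (L : u <> 0 -> is_Cseries (fun n => u ^ n / RtoC (INR (S n)))
                                   (/ u * Clog (/ (1 - u)))).
  { intros H0. eapply is_Cseries_ext.
    2:{ apply is_Cseries_scal. apply (is_Cseries_Clog u Hu). }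
    intros n. cbv beta. rewrite Cpow_S. field. split; [apply HS | exact H0]. }
  assert (L0 : u = 0 -> is_Cseries (fun n => u ^ n / RtoC (INR (S n))) (RtoC 1)).
  { intros E0. apply (is_Cseries_ext (fun n => RtoC 0 ^ n)).
    - intros n. rewrite E0. destruct n as [|n].
      + simpl. field.
      + rewrite Cpow_S. field. apply HS.
    - replace (RtoC 1) with (/ (1 - 0)) by field.
      apply is_Cseries_geom. rewrite Cmod_0. lra. }
  unfold kernel. destruct (Ceq_dec w 0) as [W|W].
  - apply L0. unfold u. rewrite W. apply injective_projections; simpl; ring.
  - destruct (Ceq_dec z 0) as [Z|Z].
    + apply L0. unfold u. rewrite Z. ring.
    + apply L. unfold u. apply Cmult_neq_0; [exact Z|].
      intros E. apply W. rewrite <- (Cconj_conj w), E.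
      apply injective_projections; simpl; ring.
Qed.

(** * The Hilbert space of coefficient sequences *)

Definition square_summable (a : nat -> C) : Prop :=
  ex_series (fun n => INR (S n) * Cmod (a n) ^ 2)%R.

(** The inner product of the Dirichlet space, on coefficient sequences: here
    [dinner f g] is [wip (coef f) (coef g)] by definition. *)
Definition wip (a b : nat -> C) : C :=
  CSeries (fun n => RtoC (INR (S n)) * a n * Cconj (b n)).

Definition sqnorm (a : nat -> C) : R := Re (wip a a).

Definition comb (x : C) (a : nat -> C) (y : C) (b : nat -> C) (n : nat) : C :=
  x * a n + y * b n.

Lemma INR_S_pos (n : nat) : (0 < INR (S n))%R.
Proof. apply lt_0_INR. lia. Qed.

Lemma square_summable_comb (x y : C) (a b : nat -> C) :
  square_summable a -> square_summable b -> square_summable (comb x a y b).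
Proof.
  intros [s Ha] [t Hb].
  apply (ex_series_comparison _ (fun n =>
    2 * Cmod x ^ 2 * (INR (S n) * Cmod (a n) ^ 2) +
    2 * Cmod y ^ 2 * (INR (S n) * Cmod (b n) ^ 2))%R).
  - intros n. assert (HS := INR_S_pos n).
    rewrite Rabs_pos_eq by (apply Rmult_le_pos; [lra | apply pow2_ge_0]).
    assert (T := Cmod_triangle (x * a n) (y * b n)). rewrite !Cmod_mult in T.
    fold (comb x a y b n) in T.
    assert (P := Cmod_ge_0 (comb x a y b n)).
    apply Rle_trans with (INR (S n) * (2 * (Cmod x * Cmod (a n)) ^ 2 +
                                       2 * (Cmod y * Cmod (b n)) ^ 2))%R.
    + apply Rmult_le_compat_l; [lra|].
      apply Rle_trans with ((Cmod x * Cmod (a n) + Cmod y * Cmod (b n)) ^ 2)%R.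
      * apply pow_incr. now split.
      * generalize (pow2_ge_0 (Cmod x * Cmod (a n) - Cmod y * Cmod (b n))). lra.
    + right. ring.
  - eexists. apply (is_series_plus (V := R_NormedModule));
      apply real_series_scal; eassumption.
Qed.

Lemma is_Cseries_wip (a b : nat -> C) :
  square_summable a -> square_summable b ->
  is_Cseries (fun n => RtoC (INR (S n)) * a n * Cconj (b n)) (wip a b).
Proof.
  intros [s Ha] [t Hb]. apply is_Cseries_CSeries.
  apply (ex_series_comparison _ (fun n =>
    INR (S n) * Cmod (a n) ^ 2 + INR (S n) * Cmod (b n) ^ 2)%R).
  - intros n. assert (HS := INR_S_pos n).
    rewrite (Rabs_pos_eq _ (Cmod_ge_0 _)), !Cmod_mult, Cmod_conj, Cmod_R.
    rewrite Rabs_pos_eq by lra.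
    replace (INR (S n) * Cmod (a n) ^ 2 + INR (S n) * Cmod (b n) ^ 2)%R
      with (INR (S n) * (Cmod (a n) ^ 2 + Cmod (b n) ^ 2))%R by ring.
    rewrite Rmult_assoc. apply Rmult_le_compat_l; [lra|].
    generalize (Cmod (a n)) (Cmod (b n)) (pow2_ge_0 (Cmod (a n) - Cmod (b n)))
      (pow2_ge_0 (Cmod (a n) + Cmod (b n))). intros; nra.
  - eexists. apply (is_series_plus (V := R_NormedModule)); eassumption.
Qed.

Lemma is_Cseries_conj (u : nat -> C) (l : C) :
  is_Cseries u l -> is_Cseries (fun n => Cconj (u n)) (Cconj l).
Proof.
  rewrite !is_Cseries_components. intros [H1 H2]. split; [exact H1|].
  rewrite im_conj. replace (- Im l)%R with (-1 * Im l)%R by ring.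
  generalize (real_series_scal (-1) _ _ H2). apply is_series_ext.
  intros n. rewrite im_conj. change (-1 * Im (u n) = - Im (u n))%R. ring.
Qed.

Lemma Cconj_R (x : R) : Cconj (RtoC x) = RtoC x.
Proof. apply injective_projections; simpl; ring. Qed.

Lemma wip_conj (a b : nat -> C) :
  square_summable a -> square_summable b -> Cconj (wip a b) = wip b a.
Proof.
  intros Ha Hb. symmetry. apply CSeries_unique.
  generalize (is_Cseries_conj _ _ (is_Cseries_wip a b Ha Hb)).
  apply is_Cseries_ext. intros n.
  rewrite !Cmult_conj, Cconj_conj, Cconj_R. ring.
Qed.

Lemma wip_comb_l (x y : C) (a b c : nat -> C) :
  square_summable a -> square_summable b -> square_summable c ->
  wip (comb x a y b) c = x * wip a c + y * wip b c.
Proof.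
  intros Ha Hb Hc. apply CSeries_unique.
  generalize (is_Cseries_plus _ _ _ _
    (is_Cseries_scal x _ _ (is_Cseries_wip a c Ha Hc))
    (is_Cseries_scal y _ _ (is_Cseries_wip b c Hb Hc))).
  apply is_Cseries_ext. intros n. unfold comb. ring.
Qed.

Lemma wip_comb_r (x y : C) (a b c : nat -> C) :
  square_summable a -> square_summable b -> square_summable c ->
  wip c (comb x a y b) = Cconj x * wip c a + Cconj y * wip c b.
Proof.
  intros Ha Hb Hc.
  rewrite <- wip_conj by auto using square_summable_comb.
  rewrite wip_comb_l, Cplus_conj, !Cmult_conj, !wip_conj by assumption.
  reflexivity.
Qed.

Lemma is_series_sqnorm (a : nat -> C) :
  square_summable a -> is_series (fun n => INR (S n) * Cmod (a n) ^ 2)%R (sqnorm a).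
Proof.
  intros Ha.
  generalize (proj1 (proj1 (is_Cseries_components _ _) (is_Cseries_wip a a Ha Ha))).
  apply is_series_ext. intros n.
  rewrite <- Cmult_assoc, re_scal_l, Cmod2_alt. destruct (a n). simpl. ring.
Qed.

Lemma sqnorm_terms_pos (a : nat -> C) (n : nat) :
  (0 <= INR (S n) * Cmod (a n) ^ 2)%R.
Proof. apply Rmult_le_pos; [apply Rlt_le, INR_S_pos | apply pow2_ge_0]. Qed.

Lemma sqnorm_ge_term (a : nat -> C) (n : nat) :
  square_summable a -> (INR (S n) * Cmod (a n) ^ 2 <= sqnorm a)%R.
Proof.
  intros Ha. apply (series_term_le _ _ n (is_series_sqnorm a Ha)).
  apply sqnorm_terms_pos.
Qed.

Lemma sqnorm_ge_0 (a : nat -> C) : square_summable a -> (0 <= sqnorm a)%R.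
Proof.
  intros Ha. eapply Rle_trans; [apply (sqnorm_terms_pos a 0)|].
  now apply sqnorm_ge_term.
Qed.

Lemma sqnorm_eq_0 (a : nat -> C) (n : nat) :
  square_summable a -> sqnorm a = 0%R -> a n = 0.
Proof.
  intros Ha H0. apply Cmod_eq_0.
  generalize (sqnorm_ge_term a n Ha) (INR_S_pos n) (Cmod_ge_0 (a n)).
  rewrite H0. intros.
  destruct (Req_dec (Cmod (a n)) 0) as [E|E]; [exact E|].
  exfalso. assert (0 < Cmod (a n) ^ 2)%R by (apply pow_lt; lra). nra.
Qed.

Lemma sqnorm_pos (a : nat -> C) (n : nat) :
  square_summable a -> a n <> 0 -> (0 < sqnorm a)%R.
Proof.
  intros Ha H. destruct (sqnorm_ge_0 a Ha) as [L|E]; [exact L|].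
  exfalso. apply H. now apply sqnorm_eq_0.
Qed.

Lemma wip_self (a : nat -> C) :
  square_summable a -> wip a a = RtoC (sqnorm a).
Proof.
  intros Ha. generalize (wip_conj a a Ha Ha). intros E.
  apply (f_equal snd) in E. unfold sqnorm.
  destruct (wip a a) as [x y]. simpl in *. apply injective_projections; simpl; lra.
Qed.

Lemma RtoC_Cmod2 (z : C) : RtoC (Cmod z ^ 2) = z * Cconj z.
Proof. rewrite <- Cmod2_conj. now rewrite RtoC_pow. Qed.

(** Expanding the norm of [|b|^2 a - <a, b> b] yields the Cauchy-Schwarz
    inequality, since the norm is nonnegative, and its equality case, since
    the vector vanishes when its norm does. *)
Lemma sqnorm_comb_defect (a b : nat -> C) :
  square_summable a -> square_summable b ->
  sqnorm (comb (RtoC (sqnorm b)) a (- wip a b) b) =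
  (sqnorm b * (sqnorm a * sqnorm b - Cmod (wip a b) ^ 2))%R.
Proof.
  intros Ha Hb. apply RtoC_inj.
  rewrite <- wip_self by auto using square_summable_comb.
  rewrite wip_comb_l, !wip_comb_r by auto using square_summable_comb.
  rewrite !wip_self, <- (wip_conj a b), Copp_conj, Cconj_R by assumption.
  rewrite RtoC_mult, RtoC_minus, RtoC_Cmod2, RtoC_mult. ring.
Qed.

Lemma cauchy_schwarz (a b : nat -> C) :
  square_summable a -> square_summable b ->
  (Cmod (wip a b) ^ 2 <= sqnorm a * sqnorm b)%R.
Proof.
  intros Ha Hb. generalize (sqnorm_comb_defect a b Ha Hb). intros E.
  assert (P := sqnorm_ge_0 _ (square_summable_comb
                (RtoC (sqnorm b)) (- wip a b) a b Ha Hb)).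
  rewrite E in P.
  destruct (sqnorm_ge_0 b Hb) as [L|Z].
  - apply Rnot_lt_le. intros Q. nra.
  - rewrite <- Z.
    assert (W : wip a b = 0).
    { apply CSeries_unique.
      replace (RtoC 0) with (0 * wip a b) by ring.
      generalize (is_Cseries_scal 0 _ _ (is_Cseries_wip a b Ha Hb)).
      apply is_Cseries_ext. intros n.
      rewrite (sqnorm_eq_0 b n Hb) by congruence.
      apply injective_projections; simpl; ring. }
    rewrite W, Cmod_0. lra.
Qed.

Lemma cauchy_schwarz_eq (a b : nat -> C) (n : nat) :
  square_summable a -> square_summable b ->
  (sqnorm a * sqnorm b <= Cmod (wip a b) ^ 2)%R ->
  RtoC (sqnorm b) * a n = wip a b * b n.
Proof.
  intros Ha Hb H.
  assert (E : (sqnorm a * sqnorm b - Cmod (wip a b) ^ 2 = 0)%R).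
  { generalize (cauchy_schwarz a b Ha Hb). lra. }
  assert (D := sqnorm_comb_defect a b Ha Hb). rewrite E, Rmult_0_r in D.
  assert (Z := sqnorm_eq_0 _ n (square_summable_comb _ _ _ _ Ha Hb) D).
  unfold comb in Z.
  replace (RtoC (sqnorm b) * a n)
    with (RtoC (sqnorm b) * a n + - wip a b * b n + wip a b * b n) by ring.
  rewrite Z. ring.
Qed.

(** * The elliptical range of a rank-one operator *)

(** This is [A B + sqrt m sqrt n <= sqrt (A^2 + m) sqrt (B^2 + n)], the
    Cauchy-Schwarz inequality in the plane, with [m = P - A^2] and
    [n = K - B^2]. *)
Lemma sum_sqrt_bound (A B X P K : R) :
  (0 <= A)%R -> (0 <= B)%R -> (0 <= X)%R ->
  (0 <= P - A ^ 2)%R -> (0 <= K - B ^ 2)%R ->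
  (X ^ 2 <= (P - A ^ 2) * (K - B ^ 2))%R ->
  (A * B + X <= sqrt P * sqrt K)%R.
Proof.
  intros HA HB HX HP HK H.
  set (m := (P - A ^ 2)%R) in *. set (n := (K - B ^ 2)%R) in *.
  assert (EP : P = (A ^ 2 + m)%R) by (unfold m; ring).
  assert (EK : K = (B ^ 2 + n)%R) by (unfold n; ring).
  assert (A2 := pow2_ge_0 A). assert (B2 := pow2_ge_0 B).
  rewrite <- sqrt_mult by lra.
  rewrite <- (sqrt_pow2 (A * B + X)) by nra.
  apply sqrt_le_1_alt.
  assert (L : (2 * (A * B) * X <= m * B ^ 2 + n * A ^ 2)%R).
  { apply Rsqr_incr_0_var; [|nra]. unfold Rsqr.
    apply Rle_trans with (4 * (A * B) ^ 2 * (m * n))%R.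
    - replace (2 * (A * B) * X * (2 * (A * B) * X))%R
        with (4 * (A * B) ^ 2 * X ^ 2)%R by ring.
      apply Rmult_le_compat_l; [|exact H]. generalize (pow2_ge_0 (A * B)). lra.
    - generalize (pow2_ge_0 (m * B ^ 2 - n * A ^ 2)). intros Q.
      replace ((m * B ^ 2 + n * A ^ 2) * (m * B ^ 2 + n * A ^ 2))%R
        with (4 * (A * B) ^ 2 * (m * n) + (m * B ^ 2 - n * A ^ 2) ^ 2)%R by ring.
      lra. }
  rewrite EP, EK. nra.
Qed.

Lemma projection_defect (f a b : nat -> C) :
  square_summable f -> square_summable a -> square_summable b ->
  sqnorm f = 1%R ->
  wip (comb 1 a (- wip a f) f) (comb 1 b (- wip b f) f) =
  wip a b - wip a f * wip f b.
Proof.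
  intros Hf Ha Hb H1.
  rewrite wip_comb_l, !wip_comb_r by auto using square_summable_comb.
  rewrite (wip_self f Hf), H1, Copp_conj, Cconj_R.
  rewrite (wip_conj b f) by assumption. ring.
Qed.

Lemma sqnorm_projection_defect (f a : nat -> C) :
  square_summable f -> square_summable a -> sqnorm f = 1%R ->
  sqnorm (comb 1 a (- wip a f) f) = (sqnorm a - Cmod (wip a f) ^ 2)%R.
Proof.
  intros Hf Ha H1. apply RtoC_inj.
  rewrite <- wip_self by auto using square_summable_comb.
  rewrite projection_defect, wip_self, RtoC_minus, RtoC_Cmod2 by assumption.
  now rewrite wip_conj.
Qed.

Lemma ellipse_bound (f k p : nat -> C) :
  square_summable f -> square_summable k -> square_summable p ->
  sqnorm f = 1%R ->
  let l := wip f k * wip p f in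
  (Cmod l + Cmod (l - wip p k) <= sqrt (sqnorm p) * sqrt (sqnorm k))%R.
Proof.
  intros Hf Hk Hp H1 l.
  assert (Cp := square_summable_comb 1 (- wip p f) p f Hp Hf).
  assert (Ck := square_summable_comb 1 (- wip k f) k f Hk Hf).
  assert (CS := cauchy_schwarz _ _ Cp Ck).
  assert (Pp := sqnorm_ge_0 _ Cp). assert (Pk := sqnorm_ge_0 _ Ck).
  rewrite !sqnorm_projection_defect in * by assumption.
  rewrite projection_defect in CS by assumption.
  replace (Cmod (l - wip p k)) with (Cmod (wip p k - wip p f * wip f k)).
  2:{ rewrite <- Cmod_opp. f_equal. unfold l. ring. }
  unfold l. rewrite Cmod_mult, Rmult_comm.
  replace (Cmod (wip f k)) with (Cmod (wip k f)).
  2:{ rewrite <- (wip_conj f k) by assumption. apply Cmod_conj. }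
  apply sum_sqrt_bound; auto using Cmod_ge_0.
Qed.

(** For real [t] the point [t a] divides the segment from 0 to [a], and this is
    Stewart's theorem for the distance from [m]. *)
Lemma Cmod2_diff_real (m a : C) (t : R) :
  (Cmod (m - RtoC t * a) ^ 2 =
   (1 - t) * Cmod m ^ 2 + t * Cmod (m - a) ^ 2 - t * (1 - t) * Cmod a ^ 2)%R.
Proof. rewrite !Cmod2_alt. destruct m, a. simpl. ring. Qed.

(** With [t = |x|^2], the equation says [m - t a = b x conj y].  Comparing moduli
    gives [|m - t a|^2 = b^2 t (1 - t)], which by [|a|^2 + b^2 = 1] is the
    quadratic equation [t^2 - B t + |m|^2 = 0] with
    [B = 1 + |m|^2 - |m - a|^2].  The hypothesis gives [2 |m| <= B], so the
    roots are real and nonnegative, with product [|m|^2 <= 1]; the smaller one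
    lies in [0, 1].  The phase of [y] is then free to match that of [m - t a]. *)
Lemma ellipse_parametrization (a m : C) (b : R) :
  (0 <= b)%R -> (Cmod a ^ 2 + b ^ 2 = 1)%R -> (Cmod m + Cmod (m - a) <= 1)%R ->
  exists x y : C, (Cmod x ^ 2 + Cmod y ^ 2 = 1)%R /\
    m = x * (a * Cconj x + RtoC b * Cconj y).
Proof.
  intros Hb Hab H.
  assert (Hm := Cmod_ge_0 m). assert (Hma := Cmod_ge_0 (m - a)).
  set (B := (1 + Cmod m ^ 2 - Cmod (m - a) ^ 2)%R).
  assert (HB : (2 * Cmod m <= B)%R) by (unfold B; nra).
  set (D := (B ^ 2 - 4 * Cmod m ^ 2)%R).
  assert (HD : (0 <= D)%R) by (unfold D; nra).
  set (t := ((B - sqrt D) / 2)%R).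
  assert (HsD := sqrt_pos D). assert (EsD := sqrt_sqrt D HD).
  assert (Et : (t * t - B * t + Cmod m ^ 2 = 0)%R).
  { unfold t. unfold D in EsD at 3.
    replace ((B - sqrt D) / 2 * ((B - sqrt D) / 2) - B * ((B - sqrt D) / 2) + Cmod m ^ 2)%R
     with ((sqrt D * sqrt D - B ^ 2 + 4 * Cmod m ^ 2) / 4)%R by field.
    rewrite EsD. field. }
  assert (Ht : (0 <= t <= 1)%R).
  { assert (sqrt D <= B)%R.
    { apply Rsqr_incr_0_var; [|lra]. unfold Rsqr. rewrite EsD. unfold D. nra. }
    assert (2 * t = B - sqrt D)%R by (unfold t; field).
    split; [lra|]. apply Rnot_lt_le. intros L. nra. }
  assert (G : (Cmod (m - RtoC t * a) ^ 2 = b ^ 2 * (t * (1 - t)))%R).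
  { rewrite Cmod2_diff_real. unfold B in Et. nra. }
  clearbody t. clear HB HD HsD EsD Et. clear D. clear B.
  destruct (Req_dec (b * t) 0) as [Z|NZ].
  (* If [b t = 0], the equation does not constrain [y] beyond its modulus. *)
  - assert (E : m = RtoC t * a).
    { assert (Q : (Cmod (m - RtoC t * a) = 0)%R).
      { replace (b ^ 2 * (t * (1 - t)))%R with (b * t * (b * (1 - t)))%R in G by ring.
        rewrite Z, Rmult_0_l in G. apply Rsqr_0_uniq. unfold Rsqr. lra. }
      apply Cmod_eq_0 in Q. replace m with (m - RtoC t * a + RtoC t * a) by ring.
      rewrite Q. ring. }
    exists (RtoC (sqrt t)), (RtoC (sqrt (1 - t))).
    rewrite !Cmod_R, !(Rabs_pos_eq (sqrt _)) by apply sqrt_pos.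
    rewrite !pow2_sqrt by lra. split; [ring|].
    rewrite !Cconj_R, E.
    replace (RtoC (sqrt t) * (a * RtoC (sqrt t) + RtoC b * RtoC (sqrt (1 - t))))
      with (RtoC (sqrt t * sqrt t) * a + RtoC (b * sqrt t * sqrt (1 - t)))
      by (rewrite !RtoC_mult; ring).
    rewrite sqrt_sqrt by lra.
    replace (b * sqrt t * sqrt (1 - t))%R with 0%R; [ring|].
    apply Rmult_integral in Z. destruct Z as [Z | Z]; rewrite Z; [ring|].
    rewrite sqrt_0. ring.
  - assert (Hb0 : (b <> 0)%R) by (intros ->; apply NZ; ring).
    assert (Ht0 : (0 < t)%R).
    { destruct Ht as [[L|E] _]; [exact L|]. exfalso. apply NZ. rewrite <- E. ring. }
    assert (Hs : (0 < sqrt t)%R) by now apply sqrt_lt_R0.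
    assert (Hs2 : (sqrt t * sqrt t = t)%R) by (apply sqrt_sqrt; lra).
    assert (Hbs : (b * sqrt t <> 0)%R) by (apply Rmult_integral_contrapositive; lra).
    assert (HbsC : RtoC (b * sqrt t) <> 0).
    { intros E. apply Hbs. now apply RtoC_inj. }
    exists (RtoC (sqrt t)), (Cconj ((m - RtoC t * a) / RtoC (b * sqrt t))).
    split.
    + rewrite Cmod_conj, Cmod_div, !Cmod_R by exact HbsC.
      unfold Rdiv. rewrite Rpow_mult_distr, pow_inv, !pow2_abs, G.
      rewrite Rpow_mult_distr, !pow2_sqrt by lra.
      field. lra.
    + rewrite Cconj_conj, Cconj_R.
      replace (RtoC (sqrt t) * (a * RtoC (sqrt t) +
                 RtoC b * ((m - RtoC t * a) / RtoC (b * sqrt t))))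
        with (RtoC (sqrt t * sqrt t) * a + RtoC (b * sqrt t) *
                 ((m - RtoC t * a) / RtoC (b * sqrt t)))
        by (rewrite !RtoC_mult; unfold Cdiv; ring).
      rewrite Hs2. field. exact HbsC.
Qed.

Lemma unit_multiple (v : nat -> C) :
  square_summable v -> (0 < sqnorm v)%R ->
  sqnorm (comb (RtoC (/ sqrt (sqnorm v))) v 0 v) = 1%R.
Proof.
  intros Hv Hpos. apply RtoC_inj.
  rewrite <- wip_self by auto using square_summable_comb.
  rewrite wip_comb_l, !wip_comb_r by auto using square_summable_comb.
  rewrite !wip_self, !Cconj_R by assumption.
  set (s := sqrt (sqnorm v)).
  assert (Hs : (0 < s)%R) by now apply sqrt_lt_R0.
  replace (sqnorm v) with (s * s)%R by (apply sqrt_sqrt; lra).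
  replace (RtoC (/ s) * (RtoC (/ s) * RtoC (s * s) + 0 * RtoC (s * s)) +
           0 * (RtoC (/ s) * RtoC (s * s) + 0 * RtoC (s * s)))
    with (RtoC (/ s * (/ s * (s * s)))) by (rewrite !RtoC_mult; ring).
  f_equal. field. lra.
Qed.

Definition delta (k n : nat) : C := if Nat.eq_dec n k then 1 else 0.

Lemma square_summable_delta (k : nat) : square_summable (delta k).
Proof.
  apply (ex_series_comparison _ (fun n => INR (S k) * 2 ^ k * (/ 2) ^ n)%R).
  - intros n. rewrite Rabs_pos_eq by apply sqnorm_terms_pos.
    unfold delta. destruct (Nat.eq_dec n k) as [->|N].
    + rewrite Cmod_1, pow1, Rmult_assoc, <- Rpow_mult_distr, Rinv_r, pow1 by lra. lra.
    + rewrite Cmod_0. replace (INR (S n) * 0 ^ 2)%R with 0%R by ring.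
      apply Rmult_le_pos; [apply Rmult_le_pos|].
      * apply pos_INR.
      * apply pow_le; lra.
      * apply pow_le; lra.
  - eexists. apply real_series_scal, is_series_geom. rewrite Rabs_pos_eq; lra.
Qed.

(** Two linearly independent vectors have a nonzero combination orthogonal to
    any given vector. *)
Lemma exists_unit_orthogonal (a : nat -> C) :
  square_summable a ->
  exists e, square_summable e /\ sqnorm e = 1%R /\ wip e a = 0.
Proof.
  intros Ha.
  assert (H : exists v n, square_summable v /\ v n <> 0 /\ wip v a = 0).
  { assert (D0 := square_summable_delta 0). assert (D1 := square_summable_delta 1).
    destruct (Ceq_dec (wip (delta 0) a) 0) as [E|N].
    - exists (delta 0), 0%nat. repeat split; try assumption.
      unfold delta. simpl. apply C1_nz.
    - exists (comb (wip (delta 1) a) (delta 0) (- wip (delta 0) a) (delta 1)), 1%nat.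
      repeat split.
      + now apply square_summable_comb.
      + unfold comb. unfold delta at 2 4. simpl. intros E. apply N.
        replace (wip (delta 0) a) with
         (- (wip (delta 1) a * 0 + - wip (delta 0) a * 1)) by ring.
        rewrite E. ring.
      + rewrite wip_comb_l by assumption. ring. }
  destruct H as (v & n & Hv & Hn & Hva).
  exists (comb (RtoC (/ sqrt (sqnorm v))) v 0 v). repeat split.
  - now apply square_summable_comb.
  - apply unit_multiple; [exact Hv|]. now apply (sqnorm_pos v n).
  - rewrite wip_comb_l, Hva by assumption. ring.
Qed.

(** Gram-Schmidt.  If [p] is a multiple of [e], any unit vector orthogonal to
    [e] serves, with [b = 0]. *)
Lemma exists_orthonormal_complement (e p : nat -> C) :
  square_summable e -> square_summable p -> sqnorm e = 1%R ->
  exists g b, square_summable g /\ sqnorm g = 1%R /\ wip g e = 0 /\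
    (0 <= b)%R /\ wip p g = RtoC b /\ (Cmod (wip p e) ^ 2 + b ^ 2 = sqnorm p)%R.
Proof.
  intros He Hp H1.
  set (q := comb 1 p (- wip p e) e).
  assert (Hq : square_summable q) by now apply square_summable_comb.
  assert (Nq : sqnorm q = (sqnorm p - Cmod (wip p e) ^ 2)%R)
    by now apply sqnorm_projection_defect.
  assert (Eq : forall c, square_summable c -> wip p c = wip q c + wip p e * wip e c).
  { intros c Hc. unfold q. rewrite wip_comb_l by assumption. ring. }
  assert (Qe : wip q e = 0).
  { unfold q. rewrite wip_comb_l, (wip_self e), H1 by assumption. ring. }
  destruct (sqnorm_ge_0 q Hq) as [L|Z].
  - set (s := sqrt (sqnorm q)).
    assert (Hs : (0 < s)%R) by now apply sqrt_lt_R0.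
    assert (Hss : (s * s = sqnorm q)%R) by (apply sqrt_sqrt; lra).
    exists (comb (RtoC (/ s)) q 0 q), s. repeat split.
    + now apply square_summable_comb.
    + now apply unit_multiple.
    + rewrite wip_comb_l, Qe by assumption. ring.
    + lra.
    + rewrite wip_comb_r, Eq, <- (wip_conj q e), Qe, wip_self, <- Hss, !Cconj_R
        by assumption.
      transitivity (RtoC (/ s * (s * s))).
      * rewrite !RtoC_mult. ring.
      * f_equal. field. lra.
    + replace (s ^ 2)%R with (s * s)%R by ring. rewrite Hss, Nq. ring.
  - destruct (exists_unit_orthogonal e He) as (g & Hg & Ng & Ge).
    exists g, 0%R. repeat split; try assumption.
    + lra.
    + rewrite Eq, <- (wip_conj g e), Ge, Cconj_R by assumption.
      assert (CS := cauchy_schwarz q g Hq Hg). rewrite <- Z, Rmult_0_l in CS.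
      assert (W : Cmod (wip q g) = 0%R).
      { apply Rsqr_0_uniq. unfold Rsqr. generalize (Cmod_ge_0 (wip q g)). nra. }
      apply Cmod_eq_0 in W. rewrite W. ring.
    + lra.
Qed.

(** [ellipse_parametrization] in the coordinates of an orthonormal pair [e, g],
    where [e = k / |k|] and [p = <p, e> e + b g]. *)
Lemma ellipse_attained (k p : nat -> C) (l : C) :
  square_summable k -> square_summable p ->
  (0 < sqnorm k)%R -> (0 < sqnorm p)%R ->
  (Cmod l + Cmod (l - wip p k) <= sqrt (sqnorm p) * sqrt (sqnorm k))%R ->
  exists f, square_summable f /\ sqnorm f = 1%R /\ l = wip f k * wip p f.
Proof.
  intros Hk Hp Pk Pp Hl.
  set (s := sqrt (sqnorm k)) in *. set (r := sqrt (sqnorm p)) in *.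
  assert (Hs : (0 < s)%R) by now apply sqrt_lt_R0.
  assert (Hr : (0 < r)%R) by now apply sqrt_lt_R0.
  assert (Hss : (s * s = sqnorm k)%R) by (apply sqrt_sqrt; lra).
  assert (Hrr : (r * r = sqnorm p)%R) by (apply sqrt_sqrt; lra).
  assert (sC : RtoC s <> 0) by (intros E; apply RtoC_inj in E; lra).
  assert (rC : RtoC r <> 0) by (intros E; apply RtoC_inj in E; lra).
  set (e := comb (RtoC (/ s)) k 0 k).
  assert (He : square_summable e) by now apply square_summable_comb.
  assert (Ne : sqnorm e = 1%R) by now apply unit_multiple.
  destruct (exists_orthonormal_complement e p He Hp Ne)
    as (g & b & Hg & Ng & Oge & Hb & Epg & Epe).
  assert (Epk : wip p k = RtoC s * wip p e).
  { unfold e. rewrite wip_comb_r, !Cconj_R, RtoC_inv by (assumption || lra).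
    field. exact sC. }
  assert (Eek : wip e k = RtoC s).
  { unfold e. rewrite wip_comb_l, wip_self, <- Hss, RtoC_mult, RtoC_inv
      by (assumption || lra).
    field. exact sC. }
  assert (Egk : wip g k = 0).
  { unfold e in Oge. rewrite wip_comb_r, !Cconj_R, RtoC_inv in Oge
      by (assumption || lra).
    replace (wip g k) with (RtoC s * (/ RtoC s * wip g k + 0 * wip g k))
      by (field; exact sC).
    rewrite Oge. ring. }
  set (a := wip p e / RtoC r). set (m := l / (RtoC s * RtoC r)).
  destruct (ellipse_parametrization a m (b / r)) as (x & y & Hxy & Hm).
  - apply Rle_mult_inv_pos; lra.
  - unfold a. rewrite Cmod_div, Cmod_R, Rabs_pos_eq by (assumption || lra).
    replace ((Cmod (wip p e) / r) ^ 2 + (b / r) ^ 2)%R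
      with ((Cmod (wip p e) ^ 2 + b ^ 2) / (r * r))%R by (field; lra).
    rewrite Epe, Hrr. field. lra.
  - unfold m, a.
    replace (l / (RtoC s * RtoC r) - wip p e / RtoC r)
      with ((l - wip p k) / RtoC (s * r))
      by (rewrite Epk, RtoC_mult; field; now split).
    rewrite <- RtoC_mult.
    assert (srC : RtoC (s * r) <> 0) by (intros E; apply RtoC_inj in E; nra).
    rewrite !Cmod_div, Cmod_R, Rabs_pos_eq by (assumption || nra).
    apply Rmult_le_reg_r with (s * r)%R; [nra|].
    replace ((Cmod l / (s * r) + Cmod (l - wip p k) / (s * r)) * (s * r))%R
      with (Cmod l + Cmod (l - wip p k))%R by (field; lra).
    lra.
  - exists (comb x e y g). repeat split.
    + now apply square_summable_comb.
    + apply RtoC_inj. rewrite <- wip_self by now apply square_summable_comb.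
      rewrite wip_comb_l, !wip_comb_r by auto using square_summable_comb.
      rewrite !wip_self, <- (wip_conj g e), Oge, Ne, Ng, Cconj_R by assumption.
      transitivity (RtoC (Cmod x ^ 2 + Cmod y ^ 2)); [|now rewrite Hxy].
      rewrite RtoC_plus, !RtoC_Cmod2. ring.
    + rewrite wip_comb_l, wip_comb_r, Eek, Egk, Epg by assumption.
      replace l with (m * (RtoC s * RtoC r)) by (unfold m; field; now split).
      rewrite Hm. unfold a.
      replace (RtoC (b / r)) with (RtoC b / RtoC r) by (rewrite RtoC_div by lra; reflexivity).
      field. exact rC.
Qed.

(** * From sequences to functions *)

Lemma Dirichlet_square_summable (f : C -> C) :
  Dirichlet f -> square_summable (coef f).
Proof. intros H. apply H. Qed.

Lemma dnorm_sqnorm (f : C -> C) : dnorm f = sqrt (sqnorm (coef f)).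
Proof. reflexivity. Qed.

Lemma expansion_value (f : C -> C) (a : nat -> C) (z : C) :
  expansion f a -> unit_disk z -> f z = CSeries (fun n => z ^ n * a n).
Proof.
  intros H Hz. symmetry. apply CSeries_unique.
  now apply (proj1 (expansion_Cpow f a)).
Qed.

Lemma expansion_scal (c : C) (f : C -> C) (a : nat -> C) :
  expansion f a -> expansion (fun z => c * f z) (fun n => c * a n).
Proof.
  rewrite !expansion_Cpow. intros H z Hz.
  generalize (is_Cseries_scal c _ _ (H z Hz)). apply is_Cseries_ext.
  intros n. ring.
Qed.

(** Square-summable sequences are bounded, so their power series converge on
    the disk. *)
Lemma Dirichlet_of_coef (a : nat -> C) :
  square_summable a -> exists f, Dirichlet f /\ coef f = a.
Proof.
  intros Ha. set (f := fun z => CSeries (fun n => z ^ n * a n)).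
  assert (Hf : expansion f a).
  { apply expansion_Cpow. intros z Hz. apply is_Cseries_CSeries.
    apply (ex_series_comparison _ (fun n => (1 + sqnorm a) * Cmod z ^ n)%R).
    - intros n. rewrite (Rabs_pos_eq _ (Cmod_ge_0 _)), Cmod_mult, Cmod_pow.
      rewrite Rmult_comm. apply Rmult_le_compat_r; [apply pow_le, Cmod_ge_0|].
      assert (T := sqnorm_ge_term a n Ha). rewrite S_INR in T.
      assert (Q := pow2_ge_0 (Cmod (a n))). assert (N := pos_INR n).
      assert (Q' := pow2_ge_0 (Cmod (a n) - 1)). nra.
    - eexists. apply real_series_scal, is_series_geom.
      now rewrite (Rabs_pos_eq _ (Cmod_ge_0 z)). }
  exists f. assert (E := coef_expansion f a Hf). split; [|exact E].
  split; [now apply (expansion_holomorphic f a)|]. now rewrite E.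
Qed.

Lemma coef_kernel (w : C) :
  (Cmod w < 1)%R ->
  coef (kernel w) = fun n => Cconj w ^ n / RtoC (INR (S n)).
Proof. intros Hw. now apply coef_expansion, kernel_expansion. Qed.

Lemma square_summable_kernel (w : C) :
  (Cmod w < 1)%R -> square_summable (coef (kernel w)).
Proof.
  intros Hw. rewrite coef_kernel by exact Hw.
  apply (ex_series_comparison _ (fun n => Cmod w ^ n)%R).
  - intros n. rewrite Rabs_pos_eq
      by apply (sqnorm_terms_pos (fun n => Cconj w ^ n / RtoC (INR (S n)))).
    assert (HS := INR_S_pos n).
    rewrite Cmod_div, Cmod_pow, Cmod_conj, Cmod_R, Rabs_pos_eq.
    2: lra.
    2: { intros E. apply RtoC_inj in E. lra. }
    replace (INR (S n) * (Cmod w ^ n / INR (S n)) ^ 2)%R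
      with (Cmod w ^ n * (Cmod w ^ n / INR (S n)))%R by (field; lra).
    assert (P : (0 <= Cmod w ^ n)%R) by apply pow_le, Cmod_ge_0.
    assert (Q : (Cmod w ^ n <= 1 ^ n)%R).
    { apply pow_incr. split; [apply Cmod_ge_0 | lra]. }
    rewrite pow1 in Q.
    rewrite <- (Rmult_1_r (Cmod w ^ n)) at 3.
    apply Rmult_le_compat_l; [exact P|].
    apply Rmult_le_reg_r with (INR (S n)); [exact HS|].
    unfold Rdiv. rewrite Rmult_assoc, Rinv_l by lra.
    generalize (pos_INR n). rewrite S_INR. lra.
  - apply ex_series_geom. now rewrite (Rabs_pos_eq _ (Cmod_ge_0 w)).
Qed.

(** The [n]-th coefficient [conj w ^ n / (n + 1)] of the kernel cancels the weight
    [n + 1], so the inner product is the power series at [w]. *)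
Lemma kernel_reproducing (w : C) (f : C -> C) (a : nat -> C) :
  (Cmod w < 1)%R -> expansion f a -> wip a (coef (kernel w)) = f w.
Proof.
  intros Hw Hf. apply CSeries_unique.
  generalize (proj1 (expansion_Cpow f a) Hf w Hw). apply is_Cseries_ext.
  intros n. rewrite coef_kernel by exact Hw.
  assert (HS : RtoC (INR (S n)) <> 0).
  { intros E. apply RtoC_inj in E. generalize (INR_S_pos n). lra. }
  rewrite Cdiv_conj, Cpow_conj, Cconj_conj, Cconj_R by exact HS.
  field. exact HS.
Qed.

Lemma kernel_sqnorm_pos (w : C) :
  (Cmod w < 1)%R -> (0 < sqnorm (coef (kernel w)))%R.
Proof.
  intros Hw. apply (sqnorm_pos _ 0); [now apply square_summable_kernel|].
  rewrite coef_kernel by exact Hw. simpl. unfold Cdiv.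
  rewrite Cmult_1_l. intros E. apply C1_nz.
  rewrite <- (Cinv_r 1) by apply C1_nz. rewrite E. ring.
Qed.

Lemma nonzero_sqnorm_pos (f : C -> C) :
  Dirichlet f -> (exists z, unit_disk z /\ f z <> 0) ->
  (0 < sqnorm (coef f))%R.
Proof.
  intros Hf (z & Hz & N). assert (Sf := Dirichlet_square_summable f Hf).
  destruct (sqnorm_ge_0 _ Sf) as [L|E]; [exact L|]. exfalso. apply N.
  rewrite (expansion_value f (coef f) z) by (apply Hf || exact Hz).
  apply CSeries_unique. replace (RtoC 0) with (0 * f z) by ring.
  generalize (is_Cseries_scal 0 _ _
    (proj1 (expansion_Cpow f (coef f)) (proj1 (proj2 Hf)) z Hz)).
  apply is_Cseries_ext. intros n.
  rewrite (sqnorm_eq_0 _ n Sf) by congruence. ring.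
Qed.

(** [psi] is the image of the constant function 1. *)
Lemma bounded_symbol_Dirichlet (w : C) (phi psi : C -> C) :
  (Cmod w < 1)%R -> (forall z, unit_disk z -> phi z = w) ->
  holomorphic_on_disk psi -> bounded_operator (wcomp psi phi) ->
  Dirichlet psi.
Proof.
  intros Hw Hphi Hpsi [HD _].
  destruct (Dirichlet_of_coef _ (square_summable_delta 0)) as (f & Hf & Ef).
  assert (F1 : f w = 1).
  { rewrite (expansion_value f (delta 0) w); [| |exact Hw].
    2: { rewrite <- Ef. apply Hf. }
    apply CSeries_unique.
    apply (is_series_decr_1 (V := C_NormedModule) (fun n => w ^ n * delta 0 n)).
    unfold delta at 2. simpl.
    replace (plus _ _) with (0 * / (1 - w)).
    2: { change (0 * / (1 - w) = 1 + - (1 * 1)). ring. }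
    generalize (is_Cseries_scal 0 _ _ (is_Cseries_geom w Hw)).
    apply is_Cseries_ext. intros n. unfold delta. simpl. ring. }
  assert (E : eq_on_disk (wcomp psi phi f) psi).
  { intros z Hz. unfold wcomp. rewrite Hphi, F1 by exact Hz. ring. }
  destruct (HD f Hf) as (_ & X & S).
  assert (P : coef psi = coef (wcomp psi phi f)).
  { apply coef_expansion. now apply (expansion_eq_on_disk _ _ _ E). }
  split; [exact Hpsi|]. rewrite P. split; [|exact S].
  now apply (expansion_eq_on_disk _ _ _ E).
Qed.

(** * The numerical range *)

(** [dinner (wcomp psi phi f) f] equals [<f, k> <psi, f>], to which
    [ellipse_bound] and [ellipse_attained] apply. *)
Lemma numerical_range_ellipse (w : C) (phi psi : C -> C) (l : C) :
  (Cmod w < 1)%R -> (forall z, unit_disk z -> phi z = w) ->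
  Dirichlet psi -> (exists z, unit_disk z /\ psi z <> 0) ->
  numerical_range (wcomp psi phi) l <->
  (Cmod l + Cmod (l - dinner psi (kernel w)) <= dnorm psi * dnorm (kernel w))%R.
Proof.
  intros Hw Hphi Hpsi Hnz.
  assert (Sk := square_summable_kernel w Hw).
  assert (Sp := Dirichlet_square_summable psi Hpsi).
  assert (T : forall f, Dirichlet f -> dinner (wcomp psi phi f) f =
     wip (coef f) (coef (kernel w)) * wip (coef psi) (coef f)).
  { intros f Hf.
    rewrite (kernel_reproducing w f) by (exact Hw || apply Hf).
    unfold dinner.
    rewrite (coef_expansion (wcomp psi phi f) (fun n => f w * coef psi n)).
    - apply CSeries_unique.
      generalize (is_Cseries_scal (f w) _ _
        (is_Cseries_wip _ _ Sp (Dirichlet_square_summable f Hf))).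
      apply is_Cseries_ext. intros n. ring.
    - apply (expansion_eq_on_disk (fun z => f w * psi z)).
      + intros z Hz. unfold wcomp. rewrite Hphi by exact Hz. ring.
      + apply expansion_scal, Hpsi. }
  rewrite !dnorm_sqnorm. split.
  - intros (f & Hf & Nf & El). rewrite El, T by exact Hf.
    apply ellipse_bound; auto using Dirichlet_square_summable.
    rewrite dnorm_sqnorm in Nf.
    rewrite <- (sqrt_sqrt (sqnorm (coef f))).
    + rewrite Nf. ring.
    + apply sqnorm_ge_0. now apply Dirichlet_square_summable.
  - intros H.
    destruct (ellipse_attained (coef (kernel w)) (coef psi) l)
      as (a & Ha & Na & El); auto using kernel_sqnorm_pos, nonzero_sqnorm_pos.
    destruct (Dirichlet_of_coef a Ha) as (f & Hf & Ef).
    exists f. split; [exact Hf|]. split.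
    + rewrite dnorm_sqnorm, Ef, Na. apply sqrt_1.
    + rewrite T, Ef by exact Hf. exact El.
Qed.

(** Equality in the triangle inequality: with [t = |l| / |q|], the hypothesis
    forces [|l - t q| = 0]. *)
Lemma degenerate_ellipse_segment (q l : C) :
  (Cmod l + Cmod (l - q) <= Cmod q)%R <-> segment 0 q l.
Proof.
  split.
  - intros H. assert (L0 := Cmod_ge_0 l). assert (D0 := Cmod_ge_0 (l - q)).
    destruct (Ceq_dec q 0) as [Q|Q].
    + exists 0%R. split; [lra|]. rewrite Q in *.
      rewrite Cmod_0 in H.
      replace (RtoC (1 - 0) * 0 + RtoC 0 * 0) with (RtoC 0) by ring.
      apply Cmod_eq_0. lra.
    + apply Cmod_gt_0 in Q. set (t := (Cmod l / Cmod q)%R).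
      assert (Et : Cmod l = (t * Cmod q)%R) by (unfold t; field; lra).
      assert (Ht : (0 <= t <= 1)%R).
      { split; [unfold t; apply Rle_mult_inv_pos; lra|].
        apply Rmult_le_reg_r with (Cmod q); [exact Q|]. rewrite <- Et. lra. }
      exists t. split; [exact Ht|].
      assert (Z : (Cmod (l - RtoC t * q) ^ 2 <= 0)%R).
      { rewrite Cmod2_diff_real.
        assert (Cmod (l - q) ^ 2 <= ((1 - t) * Cmod q) ^ 2)%R.
        { apply pow_incr. split; [exact D0 | lra]. }
        rewrite Et. nra. }
      assert (W : Cmod (l - RtoC t * q) = 0%R).
      { apply Rsqr_0_uniq. unfold Rsqr.
        generalize (pow2_ge_0 (Cmod (l - RtoC t * q))). lra. }
      apply Cmod_eq_0 in W.
      replace l with (l - RtoC t * q + RtoC t * q) by ring. rewrite W. ring.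
  - intros (t & Ht & ->).
    replace (RtoC (1 - t) * 0 + RtoC t * q) with (RtoC t * q) by ring.
    replace (RtoC t * q - q) with (RtoC (t - 1) * q)
      by (rewrite RtoC_minus; ring).
    rewrite !Cmod_mult, !Cmod_R, Rabs_pos_eq, Rabs_left1 by lra. lra.
Qed.

Theorem lemma3p4 :
  forall (w : C) (phi psi : C -> C),
    (Cmod w < 1)%R ->
    (forall z : C, unit_disk z -> phi z = w) ->
    holomorphic_on_disk psi ->
    (exists z : C, unit_disk z /\ psi z <> 0) ->
    bounded_operator (wcomp psi phi) ->
    (forall c : C, c <> 0 ->
       eq_on_disk (kernel w) (fun z => c * psi z) ->
       same_set (numerical_range (wcomp psi phi))
                (segment 0 (Cconj c * RtoC ((dnorm psi)^2)))) /\
    (dinner (kernel w) psi = 0 ->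
       same_set (numerical_range (wcomp psi phi))
                (closed_disk 0 (1 / 2 * dnorm psi * dnorm (kernel w))%R)) /\
    (~ (exists c : C, c <> 0 /\ eq_on_disk (kernel w) (fun z => c * psi z)) ->
     dinner (kernel w) psi <> 0 ->
       closed_elliptical_disk 0 (psi w) (numerical_range (wcomp psi phi))).
Proof.
  intros w phi psi Hw Hphi Hhol Hnz Hbd.
  assert (Hpsi := bounded_symbol_Dirichlet w phi psi Hw Hphi Hhol Hbd).
  assert (NR := fun l => numerical_range_ellipse w phi psi l Hw Hphi Hpsi Hnz).
  assert (Sk := square_summable_kernel w Hw).
  assert (Sp := Dirichlet_square_summable psi Hpsi).
  assert (Pk := kernel_sqnorm_pos w Hw).
  assert (Pp := nonzero_sqnorm_pos psi Hpsi Hnz).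
  assert (Rep : dinner psi (kernel w) = psi w)
    by (apply kernel_reproducing; [exact Hw | apply Hpsi]).
  split; [|split].
  - intros c Hc Ek l. rewrite NR, <- degenerate_ellipse_segment.
    assert (Ck : coef (kernel w) = fun n => c * coef psi n).
    { apply coef_expansion. apply (expansion_eq_on_disk (fun z => c * psi z)).
      - intros z Hz. symmetry. now apply Ek.
      - apply expansion_scal, Hpsi. }
    assert (Ck' : coef (kernel w) = comb c (coef psi) 0 (coef psi)).
    { rewrite Ck. apply functional_extensionality. intros n. unfold comb. ring. }
    assert (Np : (dnorm psi ^ 2 = sqnorm (coef psi))%R)
      by (rewrite dnorm_sqnorm; apply pow2_sqrt; lra).
    assert (Eq : dinner psi (kernel w) = Cconj c * RtoC (dnorm psi ^ 2)).
    { unfold dinner. fold (wip (coef psi) (coef (kernel w))).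
      rewrite Ck', wip_comb_r, wip_self, Np, Cconj_R by assumption. ring. }
    assert (Nk : dnorm (kernel w) = (Cmod c * dnorm psi)%R).
    { rewrite !dnorm_sqnorm.
      rewrite <- (sqrt_pow2 (Cmod c)) by apply Cmod_ge_0.
      rewrite <- sqrt_mult by (apply pow2_ge_0 || lra). f_equal.
      apply RtoC_inj. rewrite <- wip_self by exact Sk.
      rewrite Ck', wip_comb_l, !wip_comb_r by auto using square_summable_comb.
      rewrite wip_self, Cconj_R, RtoC_mult, RtoC_Cmod2 by exact Sp. ring. }
    rewrite Eq, Nk, Cmod_mult, Cmod_conj, Cmod_R, Rabs_pos_eq by apply pow2_ge_0.
    replace (dnorm psi * (Cmod c * dnorm psi))%R
      with (Cmod c * dnorm psi ^ 2)%R by ring.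
    reflexivity.
  - intros Hort l. rewrite NR.
    assert (E0 : dinner psi (kernel w) = 0).
    { change (wip (coef psi) (coef (kernel w)) = 0).
      rewrite <- wip_conj by assumption.
      change (Cconj (dinner (kernel w) psi) = 0). rewrite Hort. apply Cconj_R. }
    rewrite E0. unfold closed_disk.
    replace (l - 0) with l by ring. split; lra.
  - intros Hpar _. exists (dnorm psi * dnorm (kernel w))%R. split.
    (* If the foci were at least as far apart as the length of the major axis,
       equality in Cauchy-Schwarz would make the kernel a multiple of [psi]. *)
    + apply Rnot_le_lt. intros L. apply Hpar.
      replace (0 - psi w) with (- psi w) in L by ring.
      rewrite Cmod_opp, <- Rep, !dnorm_sqnorm, <- sqrt_mult in L by lra.
      set (v := dinner psi (kernel w)) in *.
      assert (L2 : (sqnorm (coef psi) * sqnorm (coef (kernel w)) <= Cmod v ^ 2)%R).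
      { rewrite <- (pow2_sqrt (sqnorm (coef psi) * sqnorm (coef (kernel w)))) by nra.
        apply pow_incr. split; [apply sqrt_pos | exact L]. }
      assert (Hv : v <> 0).
      { intros E. rewrite E, Cmod_0 in L2. nra. }
      assert (HN : RtoC (sqnorm (coef (kernel w))) <> 0).
      { intros E. apply RtoC_inj in E. lra. }
      exists (RtoC (sqnorm (coef (kernel w))) / v). split.
      * intros E. apply HN.
        replace (RtoC (sqnorm (coef (kernel w))))
          with (RtoC (sqnorm (coef (kernel w))) / v * v) by (field; exact Hv).
        rewrite E. ring.
      * intros z Hz.
        set (c := RtoC (sqnorm (coef (kernel w))) / v).
        assert (X : expansion (kernel w) (fun n => c * coef psi n)).
        { replace (fun n => c * coef psi n) with (coef (kernel w)).
          - rewrite coef_kernel by exact Hw. now apply kernel_expansion.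
          - apply functional_extensionality. intros n. unfold c.
            assert (E := cauchy_schwarz_eq _ _ n Sp Sk L2).
            change (wip (coef psi) (coef (kernel w))) with v in E.
            replace (coef (kernel w) n) with (v * coef (kernel w) n / v)
              by (field; exact Hv).
            rewrite <- E. unfold Cdiv. ring. }
        rewrite (expansion_value _ _ z X Hz). symmetry.
        apply (expansion_value (fun z => c * psi z)); [|exact Hz].
        apply expansion_scal, Hpsi.
    + intros l. rewrite NR, Rep. replace (l - 0) with l by ring. reflexivity.
Qed.
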